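(* For $z\in\mathbb{C}$ with $|z|<1$, $$\sum_{d=0}^{\infty}\zeta^{\star}(\{3,1\}^d)z^{4d}-\sum_{d=0}^{\infty}\zeta^{\star}(\{3,1\}^d,2)z^{4d+2}=\tanh(\pi z/2)\cdot\cot(\pi z/2),$$ where at $z=0$ the right-hand side is understood as its limiting value (removable singularity).
   Context: For positive integers $s_1,\ldots,s_r$ with $s_1>1$, the multiple zeta star value is $\zeta^\star(s_1,\ldots,s_r)=\sum_{k_1\ge\cdots\ge k_r\ge 1}\frac{1}{k_1^{s_1}\cdots k_r^{s_r}}$ (sum over positive integers); by convention $\zeta^\star(\emptyset)=1$ for the empty index. $\{3,1\}^d$ denotes $d$ successive repetitions of the sequence $3,1$ (the empty sequence if $d=0$). *)

(* Defs.v *)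
From mathcomp Require Import all_boot all_order all_algebra complex.
From mathcomp Require Import all_classical all_reals all_analysis.

Set Implicit Arguments.
Unset Strict Implicit.
Unset Printing Implicit Defensive.

Import Order.TTheory GRing.Theory Num.Theory.
Import numFieldNormedType.Exports.

Local Open Scope classical_set_scope.
Local Open Scope complex_scope.
Local Open Scope ring_scope.

(* [R[i]] seen through its [numFieldType] structure: the norm topology of
   MathComp-Analysis is attached to [Num.NumField.sort K] and is not found on
   the bare type [R[i]], to which [CC R] is convertible. *)
Notation CC R := (Num.NumField.sort (R[i] : numFieldType)).

(* The terms are nonnegative, so the multiple series is the unordered sum over
   all weakly decreasing tuples of positive integers. It is finite when the
   entries of [s] are positive and its head, if any, exceeds 1; for divergent
   indices [fine] returns 0. *)
Definition zeta_star (R : realType) (s : seq nat) : R :=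
  fine (\esum_(k in [set k : (size s).-tuple nat |
                      sorted geq k /\ all (leq 1) k])
          (\prod_(i < size s) ((tnth k i)%:R ^+ nth 0%N s i)^-1)%:E).

Definition rep31 (d : nat) : seq nat := flatten (nseq d [:: 3%N; 1%N]).

Definition cexp (R : realType) (z : R[i]) : R[i] :=
  (expR (complex.Re z))%:C * (cos (complex.Im z) +i* sin (complex.Im z)).

Definition csinh (R : realType) (z : R[i]) : R[i] := (cexp z - cexp (- z)) / 2.
Definition ccosh (R : realType) (z : R[i]) : R[i] := (cexp z + cexp (- z)) / 2.
Definition ctanh (R : realType) (z : R[i]) : R[i] := csinh z / ccosh z.

Definition csin (R : realType) (z : R[i]) : R[i] :=
  (cexp ('i%C * z) - cexp (- ('i%C * z))) / (2 * 'i%C).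
Definition ccos (R : realType) (z : R[i]) : R[i] :=
  (cexp ('i%C * z) + cexp (- ('i%C * z))) / 2.
Definition ccot (R : realType) (z : R[i]) : R[i] := ccos z / csin z.

Definition tanh_cot (R : realType) (z : CC R) : CC R :=
  ctanh ((pi : R)%:C * z / 2) * ccot ((pi : R)%:C * z / 2).

(* Main.v *)
Require Import Defs.
From mathcomp Require Import all_boot all_order all_algebra complex.
From mathcomp Require Import all_classical all_reals all_analysis.
From mathcomp Require Import ring lra zify.
Import Order.TTheory GRing.Theory Num.Theory.
Import numFieldNormedType.Exports.
Local Open Scope classical_set_scope.
Local Open Scope complex_scope.
Local Open Scope ring_scope.

(** Write x = z^2. Cut every sum at k_1 <= n and let F_n and G_n be the two
    generating functions of the cut star sums, and H_n, K_n the analogous series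
    for the same indices preceded by one more entry 1. Peeling off the largest
    index gives a first order system for D = F - G and E = H - K:
<<
      D_n - D_(n-1) = - x / n^2 + (z / n)^3 E_n,
      E_n - E_(n-1) = (z / n) D_n,          D_0 = 1, E_0 = 0.
>>
    Because |z| < 1 the step n is invertible, so the solution is unique
    ([solution_unique]), and it can be written down explicitly. With the ratios
    p(n,k) = binomial(2n, n+k) / binomial(2n, n) and the partial products W_k
    of (i^2 + (-1)^i x) / (i^2 - (-1)^i x) over 1 <= i <= k,
<<
      D_n = 1 + sum_(1 <= k <= n) p(n,k) (W_k - W_(k-1)),
      E_n = z * sum_(1 <= k <= n) p(n,k) (W_k + W_(k-1)) / k.
>>
    Both recurrences reduce to one telescoping sum ([sum_telescope_alt]), which
    uses only (n + k) p(n,k) = (n - k + 1) p(n,k-1) and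
    k^2 (W_k - W_(k-1)) = (-1)^k x (W_k + W_(k-1)).

    It remains to let n go to infinity. A uniform bound by 2 on the cut star
    sums, obtained by an induction on n that is exact enough to be preserved
    ([zeta_trunc31_le]), makes F_n and G_n converge to the two series of the
    statement by Tannery's theorem ([tannery]). For fixed k the ratio p(n,k)
    tends to 1 and W_k - W_(k-1) = O(1/k^2), so the same theorem shows that D_n
    tends to the infinite product W ([solution_even_cvg]).

    Finally W is a quotient of values of the product
    sin y = y prod (1 - y^2 / (k pi)^2): the factors of W of odd index are
    those of cos / cosh, the factors of even index those of sinh / sin, at
    pi z / 2 ([alt_prod_even], [alt_prod_cvg]). The sine product for complex y
    ([csin_product]) is proved from the doubling formulas alone: iterating them
    writes sin (2^(n+1) t) as a finite product in sin^2 t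
    ([csin_finite_prod]), and Tannery's theorem for products ([tannery_prod])
    gives the limit at t = y / 2^(n+1). *)

Set Implicit Arguments.
Unset Strict Implicit.
Unset Printing Implicit Defensive.

(** * Solution of the recurrence by telescoping *)

(** This is binomial(2n, n+k) / binomial(2n, n). The product form vanishes by itself
    for k > n and gives the recurrence in k at once. *)
Definition binom_ratio (K : fieldType) (n k : nat) : K :=
  \prod_(i < k) ((n%:R - i%:R) / (n + i.+1)%:R).

(** The sign alternates with the index, so that numerators and denominators
    interleave the sine and the hyperbolic sine products. *)
Definition alt_prod (K : fieldType) (x : K) (k : nat) : K :=
  \prod_(i < k) ((i.+1%:R ^+ 2 + (-1) ^+ i.+1 * x)
                 / (i.+1%:R ^+ 2 - (-1) ^+ i.+1 * x)).

(** Half of the solution (D, E) of the system for the cut generating functions;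
    the other half is z times [solution_odd]. *)
Definition solution_even (K : fieldType) (x : K) (n : nat) : K :=
  1 + \sum_(k < n) binom_ratio K n k.+1 * (alt_prod x k.+1 - alt_prod x k).

Definition solution_odd (K : fieldType) (x : K) (n : nat) : K :=
  \sum_(k < n) binom_ratio K n k.+1 * (alt_prod x k.+1 + alt_prod x k) / k.+1%:R.

Lemma binom_ratioS (K : numFieldType) n k :
  binom_ratio K n k.+1 * (n%:R + k.+1%:R) = binom_ratio K n k * (n%:R - k%:R).
Proof.
have nz : (n%:R + k.+1%:R : K) != 0 by rewrite -natrD pnatr_eq0 addnS.
by rewrite /binom_ratio big_ord_recr /= natrD -mulrA mulfVK.
Qed.

Lemma binom_ratio_small (K : numFieldType) n k :
  (n < k)%N -> binom_ratio K n k = 0.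
Proof.
by move=> nk; rewrite /binom_ratio (bigD1 (Ordinal nk)) //= subrr !mul0r.
Qed.

(** The ratio p(n-1,k) / p(n,k) is 1 - k^2/n^2; this is why a step of n inserts the
    weight k^2 in a sum against p(n,k). *)
Lemma binom_ratio_pred (K : numFieldType) n k :
  binom_ratio K n.+1 k * (n.+1%:R ^+ 2 - k%:R ^+ 2)
  = n.+1%:R ^+ 2 * binom_ratio K n k.
Proof.
elim: k => [|k IH]; first by rewrite /binom_ratio !big_ord0; ring.
have h1 := binom_ratioS K n.+1 k; have h2 := binom_ratioS K n k.
have nz : (n%:R + k.+1%:R : K) != 0 by rewrite -natrD pnatr_eq0 addnS.
apply: (mulIf nz); rewrite -[RHS]mulrA h2.
have -> : n.+1%:R ^+ 2 * (binom_ratio K n k * (n%:R - k%:R))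
   = (n.+1%:R ^+ 2 * binom_ratio K n k) * (n%:R - k%:R) by ring.
rewrite -IH.
transitivity ((binom_ratio K n.+1 k.+1 * (n.+1%:R + k.+1%:R)) * (n.+1%:R - k.+1%:R) *
  (n%:R + k.+1%:R)); first by ring.
rewrite h1 -!natr1; ring.
Qed.

Section ClosedForm.
Variables (K : numFieldType) (z : K).
Let x := z ^+ 2.
Hypothesis nz_den : forall i, i.+1%:R ^+ 2 - (-1) ^+ i.+1 * x != 0 :> K.

(** One factor of the product in Cayley form: it links the differences of W, which
    occur in D, to the sums of W, which occur in E. *)
Lemma alt_prodS k :
  k.+1%:R ^+ 2 * (alt_prod x k.+1 - alt_prod x k)
  = (-1) ^+ k.+1 * x * (alt_prod x k.+1 + alt_prod x k).
Proof.
rewrite /alt_prod big_ord_recr /=; set P := \prod_(i < k) _.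
have := nz_den k; move: (_ * x) (_ ^+ 2) => e m h.
have : (m - e) / (m - e) = 1 by rewrite divff.
move: (m - e)^-1 => D hD; apply/eqP; rewrite -subr_eq0; apply/eqP.
transitivity (P * ((m - e) * D - 1) * (m + e)); first by ring.
by rewrite hD subrr mulr0 mul0r.
Qed.

(** The common core of both recurrences: e = -1 serves the step of D, e = 1 the
    step of E. After (n + k + 1) p(n,k+1) = (n - k) p(n,k) the summand is a
    difference of consecutive terms. *)
Lemma sum_telescope_alt (e : K) n :
  e * e = 1 ->
  \sum_(k < n) e ^+ k.+1 * binom_ratio K n k.+1 *
    ((n%:R - k.+1%:R) * alt_prod x k.+1 - e * (n%:R + k.+1%:R) * alt_prod x k)
  = - n%:R.
Proof.
move=> e2.
(* The primitive of the summand: its value at n is 0 and at 0 it is n. *)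
pose T k : K := e ^+ k * binom_ratio K n k * (n%:R - k%:R) * alt_prod x k.
rewrite (eq_bigr (fun k : 'I_n => T k.+1 - T k)).
  rewrite -(big_mkord xpredT (fun k => T k.+1 - T k)) telescope_sumr //.
  by rewrite /T subrr mulr0 mul0r /binom_ratio /alt_prod !big_ord0 expr0; ring.
move=> k _; rewrite /T.
have -> : e ^+ k * binom_ratio K n k * (n%:R - k%:R) * alt_prod x k
  = e * e * (e ^+ k * (binom_ratio K n k * (n%:R - k%:R)) * alt_prod x k).
  by rewrite e2; ring.
by rewrite -binom_ratioS exprS; ring.
Qed.

Lemma binom_ratio_sum_pred n (f : nat -> K) :
  \sum_(k < n.+1) binom_ratio K n.+1 k.+1 * f k
  - \sum_(k < n) binom_ratio K n k.+1 * f k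
  = n.+1%:R ^- 2 * \sum_(k < n.+1) binom_ratio K n.+1 k.+1 * (k.+1%:R ^+ 2 * f k).
Proof.
have -> : \sum_(k < n) binom_ratio K n k.+1 * f k =
          \sum_(k < n.+1) binom_ratio K n k.+1 * f k.
  by rewrite big_ord_recr /= binom_ratio_small // mul0r addr0.
rewrite -sumrB big_distrr; apply: eq_bigr => k _ /=.
have nz : (n.+1%:R : K) ^+ 2 != 0 by rewrite expf_neq0 // pnatr_eq0.
have := binom_ratio_pred K n k.+1.
move: (binom_ratio K n.+1 k.+1) (binom_ratio K n k.+1) (n.+1%:R ^+ 2) nz => a b m nz h.
have -> : b = m^-1 * (m * b) by rewrite mulKf.
by rewrite -h; field.
Qed.

Lemma solution_evenS n :
  solution_even x n.+1 - solution_even x n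
  = - x / n.+1%:R ^+ 2 + x ^+ 2 / n.+1%:R ^+ 3 * solution_odd x n.+1.
Proof.
have nz : (n.+1%:R : K) != 0 by rewrite pnatr_eq0.
rewrite /solution_even opprD addrACA subrr add0r.
rewrite (binom_ratio_sum_pred n (fun k => alt_prod x k.+1 - alt_prod x k)).
have h : \sum_(k < n.+1) binom_ratio K n.+1 k.+1 *
      (k.+1%:R ^+ 2 * (alt_prod x k.+1 - alt_prod x k)) =
   x / n.+1%:R * (- n.+1%:R) + x ^+ 2 / n.+1%:R * solution_odd x n.+1.
  rewrite -(@sum_telescope_alt (-1) n.+1) ?mulrNN ?mulr1 // /solution_odd.
  rewrite !big_distrr -big_split /=; apply: eq_bigr => k _.
  have nk : (k.+1%:R : K) != 0 by rewrite pnatr_eq0.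
  have es : (-1) ^+ k.+1 * (-1) ^+ k.+1 = 1 :> K by rewrite -expr2 sqrr_sign.
  have hk := alt_prodS k.
  apply: (mulfI nz).
  move: hk es; move: (alt_prod x k.+1) (alt_prod x k) ((-1) ^+ k.+1 : K).
  move: nk nz; move: (k.+1%:R : K) (n.+1%:R : K) (binom_ratio _ _ _).
  move=> m N b nm nN W' W e hk es.
  have -> : N * (x / N * (e * b * ((N - m) * W' - -1 * (N + m) * W)) +
       x ^+ 2 / N * (b * (W' + W) / m)) =
     b * (N * (e * x * (W' + W)) - x * e / m * (m ^+ 2 * (W' - W)) + x ^+ 2 / m * (W' + W)).
    by field; rewrite nm nN.
  rewrite hk.
  have -> : x * e / m * (e * x * (W' + W)) = e * e * (x ^+ 2 / m * (W' + W)) by ring.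
  by rewrite es; ring.
rewrite h; move: (n.+1%:R) nz => m nz; move: (solution_odd _ _) => c; by field.
Qed.

Lemma solution_oddS n :
  solution_odd x n.+1 - solution_odd x n = solution_even x n.+1 / n.+1%:R.
Proof.
have nz : (n.+1%:R : K) != 0 by rewrite pnatr_eq0.
have oddE m : solution_odd x m = \sum_(k < m) binom_ratio K m k.+1 *
    ((alt_prod x k.+1 + alt_prod x k) / k.+1%:R).
  by apply: eq_bigr => k _; rewrite mulrA.
rewrite !oddE (binom_ratio_sum_pred n (fun k => (alt_prod x k.+1 + alt_prod x k) /
  k.+1%:R)).
have h := @sum_telescope_alt 1 n.+1 (mulr1 1).
apply: (mulfI nz); apply: (mulfI nz); rewrite /solution_even.
have -> : n.+1%:R * (n.+1%:R * ((1 + \sum_(k < n.+1) binom_ratio K n.+1 k.+1 *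
   (alt_prod x k.+1 - alt_prod x k)) / n.+1%:R)) = n.+1%:R +
   n.+1%:R * \sum_(k < n.+1) binom_ratio K n.+1 k.+1 *
   (alt_prod x k.+1 - alt_prod x k).
  by move: (\sum_(_ < _) _) (n.+1%:R) nz => s m nz; field.
have -> t : n.+1%:R * (n.+1%:R * (n.+1%:R ^- 2 * t)) = t :> K.
  by move: (n.+1%:R) nz => m nz; field.
have -> t : n.+1%:R + t = - (- n.+1%:R) + t :> K by rewrite opprK.
rewrite -h big_distrr -sumrN -big_split /=; apply: eq_bigr => k _.
have nk : (k.+1%:R : K) != 0 by rewrite pnatr_eq0.
rewrite expr1n; move: (binom_ratio _ _ _) (alt_prod _ _) (alt_prod _ _) => b W' W.
by move: (k.+1%:R) (n.+1%:R) nk => m N nm; field.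
Qed.

(** The system determines its solution since no step is singular: eliminating E_n
    leaves the factor 1 - (z/n)^4 in front of D_n. *)
Lemma solution_unique (D E : nat -> K) :
  (forall n, z ^+ 4 != n.+1%:R ^+ 4) -> D 0%N = 1 -> E 0%N = 0 ->
  (forall n, D n.+1 - D n = - x / n.+1%:R ^+ 2 + z ^+ 3 / n.+1%:R ^+ 3 * E n.+1) ->
  (forall n, E n.+1 - E n = z / n.+1%:R * D n.+1) ->
  forall n, D n = solution_even x n.
Proof.
move=> nz4 D0 E0 DS ES n.
suff [] : D n = solution_even x n /\ E n = z * solution_odd x n by [].
elim: n => [|n [IHD IHE]].
  by rewrite /solution_even /solution_odd !big_ord0 addr0 mulr0.
have nz : (n.+1%:R : K) != 0 by rewrite pnatr_eq0.
have := DS n; have := ES n; have := solution_evenS n; have := solution_oddS n.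
rewrite IHD IHE; move:
  (solution_even x n.+1) (solution_odd x n.+1) (solution_even x n) => a b a0.
move: (solution_odd x n) (D n.+1) (E n.+1) => b0 d e.
move: (nz4 n) nz; move: (n.+1%:R : K) => m n4 nz hb ha he hd.
(* The deviations from the explicit solution satisfy the homogeneous step,
   whose determinant is 1 - (z/m)^4. *)
have {}he : e - z * b = z / m * (d - a).
  have -> : e - z * b = (e - z * b0) - z * (b - b0) by ring.
  by rewrite he hb; ring.
have hd1 : (d - a) * (m ^+ 4 - z ^+ 4) = 0.
  have h1 : d - a = z ^+ 3 / m ^+ 3 * (e - z * b).
    have -> : d - a = (d - a0) - (a - a0) by ring.
    by rewrite hd ha /x; ring.
  have h2 : d - a = z ^+ 4 / m ^+ 4 * (d - a) by rewrite {1}h1 he; field.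
  by apply/eqP; rewrite mulrBr subr_eq0 {1}h2; apply/eqP; field.
have da : d - a = 0.
  by move/eqP: hd1; rewrite mulf_eq0 => /orP[/eqP //|]; rewrite subr_eq0 eq_sym (negPf n4).
split; first by apply/eqP; rewrite -subr_eq0 da.
by apply/eqP; rewrite -subr_eq0 he da mulr0.
Qed.

End ClosedForm.

(** * Truncated star sums *)

(** The largest index is summed last, so a step of n only adds the term with
    k_1 = n. *)
Fixpoint zeta_trunc (R : fieldType) (s : seq nat) (n : nat) : R :=
  if s is a :: s' then \sum_(1 <= k < n.+1) (k%:R ^+ a)^-1 * zeta_trunc R s' k
  else 1.

Lemma zeta_trunc0 (R : fieldType) a s : zeta_trunc R (a :: s) 0 = 0.
Proof. by rewrite /= big_geq. Qed.

Lemma zeta_truncS (R : fieldType) a s n :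
  zeta_trunc R (a :: s) n.+1 =
  zeta_trunc R (a :: s) n + (n.+1%:R ^+ a)^-1 * zeta_trunc R s n.+1.
Proof. by rewrite /= big_nat_recr. Qed.

Lemma zeta_trunc_ge0 (R : numFieldType) s n : 0 <= zeta_trunc R s n.
Proof.
elim: s n => [|a s IH] n /=; first exact: ler01.
by apply: sumr_ge0 => k _; rewrite mulr_ge0 ?invr_ge0 ?exprn_ge0.
Qed.

Definition zeta_term (R : fieldType) (s : seq nat) (k : (size s).-tuple nat) : R :=
  \prod_(i < size s) ((tnth k i)%:R ^+ nth 0%N s i)^-1.

Lemma zeta_term_ge0 (R : numFieldType) s k : 0 <= zeta_term R (s := s) k.
Proof. by apply: prodr_ge0 => i _; rewrite invr_ge0 exprn_ge0. Qed.

Lemma zeta_term_cons (R : fieldType) a s j (k : (size s).-tuple nat) :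
  zeta_term R (s := a :: s) [tuple of j :: k] = (j%:R ^+ a)^-1 * zeta_term R k.
Proof.
rewrite /zeta_term big_ord_recl /= tnth0; congr (_ * _).
by apply: eq_bigr => i _; rewrite tnthS.
Qed.

Section StarSums.
Variable R : realType.
Local Notation zs := (zeta_trunc R).

Definition chains_below r (j : nat) : set (r.-tuple nat) :=
  [set k | path geq j k /\ all (leq 1) k].
Arguments chains_below : clear implicits.

(** Summation over the first index of a decreasing tuple. The set I constrains only
    that index, so that the lemma covers both the bounded sums and the full one;
    the constant c absorbs the powers of the indices already fixed. *)
Lemma esum_head (a : nat) (s : seq nat) (I : set nat) (c : R) :
  0 <= c ->
  (forall j c, 0 <= c ->
     \esum_(k in chains_below (size s) j) (c * zeta_term R k)%:E
     = (c * zs s j)%:E) ->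
  \esum_(k in [set k : (size (a :: s)).-tuple nat |
            [/\ I (head 0%N k), sorted geq k & all (leq 1) k]])
     (c * zeta_term R (s := a :: s) k)%:E
  = \esum_(j in [set j | I j /\ (1 <= j)%N]) (c * ((j%:R ^+ a)^-1 * zs s j))%:E.
Proof.
move=> c0 H.
pose e (p : nat * (size s).-tuple nat) : (size (a :: s)).-tuple nat :=
  [tuple of p.1 :: p.2].
rewrite (reindex_esum ([set j | I j /\ (1 <= j)%N] `*`` chains_below (size s)) _ e).
- rewrite -(@esum_esum _ _ _ _ _ (fun j k => (c * zeta_term R (s := a ::
  s) (e (j, k)))%:E)).
    apply: eq_esum => j [_ j1].
    rewrite mulrA -H ?mulr_ge0 ?invr_ge0 ?exprn_ge0 //.
    by apply: eq_esum => k _; rewrite zeta_term_cons mulrA.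
  by move=> j k _ _; rewrite lee_fin mulr_ge0 // zeta_term_ge0.
- split.
  + move=> [j k] /= [[Ij j1] [pk ak]]; split => //=.
    by rewrite j1 ak.
  + move=> [j k] [j' k'] _ _ /(congr1 val) /= [-> kk'].
    by congr pair; exact: val_inj.
  + move=> t [It st at_]; exists (thead t, [tuple of behead t]).
      move: It st at_; rewrite {1 2 3}(tuple_eta t) /= => It st /andP[h1 ht].
      by split; [split|split].
    by rewrite /e /= [RHS]tuple_eta.
Qed.

Lemma esum_chains_below s j (c : R) : 0 <= c ->
  \esum_(k in chains_below (size s) j) (c * zeta_term R k)%:E
  = (c * zs s j)%:E.
Proof.
elim: s j c => [|a s IH] j c c0.
  have -> : chains_below 0 j = [set nil_tuple nat].
    apply/seteqP; split => [k _|k -> //]; exact: tuple0.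
  rewrite esum_set1 ?lee_fin ?mulr_ge0 ?zeta_term_ge0 //.
  by rewrite /zeta_term big_ord0.
have -> : chains_below (size (a :: s)) j = [set k : (size (a :: s)).-tuple nat |
            [/\ (head 0%N k <= j)%N, sorted geq k & all (leq 1) k]].
  apply/seteqP; split => k; rewrite /chains_below /= (tuple_eta k) /=.
    by case=> /andP[-> ->] ->.
  by case=> -> -> ->.
rewrite (@esum_head a s [set i | (i <= j)%N]) //.
rewrite -[RHS]/((c * \sum_(1 <= k < j.+1) (k%:R ^+ a)^-1 * zs s k)%:E) mulr_sumr.
have -> : [set i | [set i | (i <= j)%N] i /\ (1 <= i)%N]
        = [set` index_iota 1 j.+1].
  apply/seteqP; split => i /=; rewrite mem_index_iota ltnS.
    by case=> -> ->.
  by case/andP => -> ->.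
rewrite esum_fset //; last first.
  by move=> i _; rewrite lee_fin mulr_ge0 // mulr_ge0 ?zeta_trunc_ge0 // invr_ge0 exprn_ge0.
  exact: finite_seq.
rewrite -fsbig_seq ?iota_uniq // -sumEFin.
by apply: eq_bigr => i _.
Qed.

(** The unordered sum is the supremum of the truncations as soon as these are
    bounded: all terms are nonnegative. *)
Lemma cvg_zeta_trunc a s (M : R) : (forall n, zs (a :: s) n <= M) ->
  zs (a :: s) n @[n --> \oo] --> zeta_star R (a :: s).
Proof.
move=> ub.
have nd : nondecreasing_seq (zs (a :: s)).
  apply/nondecreasing_seqP => n.
  by rewrite zeta_truncS lerDl mulr_ge0 ?zeta_trunc_ge0 // invr_ge0 exprn_ge0.
have cv : cvgn (zs (a :: s)).
  by apply: nondecreasing_is_cvgn => //; exists M => _ [n _ <-].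
suff -> : zeta_star R (a :: s) = limn (zs (a :: s)) by [].
rewrite /zeta_star.
have := @esum_head a s setT 1 ler01 (@esum_chains_below s).
under [in X in X -> _]eq_esum do rewrite mul1r.
have -> : [set k : (size (a :: s)).-tuple nat |
    [/\ [set: nat] (head 0%N k), sorted geq k & all (leq 1) k]] =
    [set k | sorted geq k /\ all (leq 1) k].
  by apply/seteqP; split => k /= [].
rewrite /zeta_term => ->.
under eq_esum do rewrite mul1r.
have -> : [set j | [set: nat] j /\ (1 <= j)%N] = [set j | (1 <= j)%N].
  by apply/seteqP; split => k /= [].
rewrite -(@nneseries_esum R (fun j => ((j%:R ^+ a)^-1 * zs s j)%:E) (fun j => 1 <= j)%N);
  last first.
  by move=> n _; rewrite lee_fin mulr_ge0 ?zeta_trunc_ge0 // invr_ge0 exprn_ge0.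
rewrite -[RHS]/(fine (limn (zs (a :: s)))%:E); congr fine.
apply/cvg_lim => //; rewrite -cvg_shiftS /=.
rewrite (_ : (fun n => _) = EFin \o zs (a :: s)).
  by apply: cvg_EFin; [exact: nearW|exact: cv].
apply/funext => n /=.
by rewrite big_mkcond big_nat_recl //= add0e -sumEFin big_add1.
Qed.
End StarSums.

(** * Uniform bounds for the truncated sums *)

Section Bounds.
Variable R : realFieldType.
Local Notation zs := (zeta_trunc R).

(** The product of k^2 / (k^2 - 1) over 2 <= k <= n. It is the growth allowed by the
    recurrence at z = 1, where (1 + 1/n^2) / (1 - 1/n^4) = 1 / (1 - 1/n^2). *)
Definition trunc_bound (n : nat) : R := 2 * n%:R / n.+1%:R.
Local Notation c := trunc_bound.

Lemma trunc_boundS n : c n.+1 = c n + 2 / (n.+1%:R * n.+2%:R).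
Proof.
rewrite /trunc_bound -!natr1; have := ler0n R n; move: (n%:R) => m m0.
by field; rewrite !gt_eqF //; lra.
Qed.

Lemma trunc_bound_ge0 n : 0 <= c n.
Proof. by rewrite divr_ge0 // mulr_ge0. Qed.

Lemma trunc_bound_le2 n : c n <= 2.
Proof.
by rewrite ler_pdivrMr // ler_pM2l // ler_nat.
Qed.

Lemma zeta_trunc1_le s : (forall n, zs s n.+1 <= c n.+1) ->
  forall n, zs (1%N :: s) n <= n%:R * c n.
Proof.
move=> H; elim=> [|n IH]; first by rewrite zeta_trunc0 mul0r.
rewrite zeta_truncS expr1; apply: (le_trans (lerD IH (ler_wpM2l _ (H n)))).
  by rewrite invr_ge0.
have c0 := trunc_bound_ge0 n.
have h : n.+1%:R * c n.+1 - (n%:R * c n + n.+1%:R^-1 * c n.+1) =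
   2 * n%:R / n.+1%:R.
  rewrite /trunc_bound -!natr1; have := ler0n R n; move: (n%:R) => m m0.
  by field; rewrite !gt_eqF //; lra.
by rewrite -subr_ge0 h divr_ge0 // mulr_ge0.
Qed.

(** Prefixing 3, 1 keeps the bound because
    c(n-1) + (n-1) c(n-1) / n^3 + c(n) / n^4 <= c(n). A bound such as zeta(2)
    per pair 3, 1 would only give convergence in a smaller disc. *)
Lemma zeta_trunc31_le s : (forall n, zs s n.+1 <= c n.+1) ->
  forall n, zs (3%N :: 1%N :: s) n <= c n.
Proof.
move=> H; elim=> [|n IH]; first by rewrite zeta_trunc0 trunc_bound_ge0.
rewrite zeta_truncS [zs (1%N :: s) _]zeta_truncS expr1.
have h1 := zeta_trunc1_le H n.
apply: (@le_trans _ _ (c n + (n.+1%:R ^+ 3)^-1 * (n%:R * c n + n.+1%:R^-1 * c n.+1))).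
  rewrite lerD // ler_wpM2l ?invr_ge0 ?exprn_ge0 // lerD //.
  by rewrite ler_wpM2l ?invr_ge0.
have h : c n.+1 - (c n + (n.+1%:R ^+ 3)^-1 * (n%:R * c n + n.+1%:R^-1 * c n.+1)) =
   2 * n%:R / n.+1%:R ^+ 4.
  rewrite /trunc_bound -!natr1; have := ler0n R n; move: (n%:R) => m m0.
  by field; rewrite !gt_eqF //; lra.
by rewrite -subr_ge0 h divr_ge0 ?mulr_ge0 ?exprn_ge0.
Qed.

Lemma zeta_trunc_rep31_le s : (forall n, zs s n.+1 <= c n.+1) ->
  forall d n, zs (rep31 d ++ s) n.+1 <= c n.+1.
Proof.
move=> H; elim=> [|d IH] n; first exact: H.
exact: (zeta_trunc31_le IH).
Qed.

Lemma zeta_trunc_nil_le n : zs [::] n.+1 <= c n.+1.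
Proof.
by rewrite /= ler_pdivlMr // mul1r -natrM ler_nat; lia.
Qed.

Lemma zeta_trunc2_le n : zs [:: 2%N] n.+1 <= c n.+1.
Proof.
elim: n => [|n IH]; first
  by rewrite /zeta_trunc big_nat1 expr1n invr1 mulr1 /trunc_bound; lra.
rewrite zeta_truncS [zs [::] _]/= mulr1 (trunc_boundS n.+1) lerD //.
rewrite ler_pdivlMr ?mulr_gt0 // mulrC ler_pdivrMr ?exprn_gt0 //.
by rewrite -natrM -natrX -natrM ler_nat; nia.
Qed.

End Bounds.

(** * Dominated convergence for complex series and products *)

Section ComplexLimits.
Variable R : realType.
Local Notation C := (CC R).

Lemma normRe_le (z : C) : `|complex.Re z|%:C <= `|z|.
Proof.
by rewrite [X in _ <= X]normc_def lecR -sqrtr_sqr ler_wsqrtr // lerDl sqr_ge0.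
Qed.

Lemma normIm_le (z : C) : `|complex.Im z|%:C <= `|z|.
Proof.
by rewrite [X in _ <= X]normc_def lecR -sqrtr_sqr ler_wsqrtr // lerDr sqr_ge0.
Qed.

Lemma norm_le_ReIm (z : C) : `|z| <= (`|complex.Re z| + `|complex.Im z|)%:C.
Proof.
rewrite [X in X <= _]normc_def lecR.
rewrite -[leRHS]ger0_norm ?addr_ge0 // -[leRHS]sqrtr_sqr ler_wsqrtr //.
rewrite sqrrD !real_normK ?num_real // addrAC lerDl mulrn_wge0 // mulr_ge0 //.
Qed.

(** The metric of the complex field is tested against complex positive radii, which
    are real; coordinates are then enough. *)
Lemma cvg_complex (T : Type) (F : set_system T) (FF : Filter F) (u : T -> C) (l : C) :
  complex.Re (u n) @[n --> F] --> complex.Re l ->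
  complex.Im (u n) @[n --> F] --> complex.Im l ->
  u @ F --> l.
Proof.
move=> hr hi; apply/cvgrPdist_lt => e e0.
have [e' ee'] : exists e', e = e'%:C by apply/complex_realP/gtr0_real.
rewrite {e}ee' in e0 *; have {}e0 : 0 < e' by rewrite -ltcR.
have e2 : 0 < e' / 2 by rewrite divr_gt0.
move/cvgrPdist_lt : hr => /(_ _ e2) hr; move/cvgrPdist_lt : hi => /(_ _ e2) hi.
near=> n.
apply: (le_lt_trans (norm_le_ReIm _)); rewrite ltcR.
have h1 : `|complex.Re l - complex.Re (u n)| < e' / 2 by near: n.
have h2 : `|complex.Im l - complex.Im (u n)| < e' / 2 by near: n.
have -> : complex.Re (l - u n) = complex.Re l - complex.Re (u n).
  by case: (l) (u n) => [a b] [a' b'].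
have -> : complex.Im (l - u n) = complex.Im l - complex.Im (u n).
  by case: (l) (u n) => [a b] [a' b'].
lra.
Unshelve. all: by end_near.
Qed.

Lemma cvg_Re (T : Type) (F : set_system T) (FF : Filter F) (u : T -> C) (l : C) :
  u @ F --> l -> complex.Re (u n) @[n --> F] --> complex.Re l.
Proof.
move=> /cvgrPdist_lt h; apply/cvgrPdist_lt => e e0.
have /h{}h : 0 < e%:C :> C by rewrite ltcR.
apply: filterS h => n h.
rewrite -ltcR; apply: le_lt_trans h.
have -> : complex.Re l - complex.Re (u n) = complex.Re (l - u n).
  by case: (l) (u n) => [a b] [a' b'].
exact: normRe_le.
Qed.

Lemma cvg_Im (T : Type) (F : set_system T) (FF : Filter F) (u : T -> C) (l : C) :
  u @ F --> l -> complex.Im (u n) @[n --> F] --> complex.Im l.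
Proof.
move=> /cvgrPdist_lt h; apply/cvgrPdist_lt => e e0.
have /h{}h : 0 < e%:C :> C by rewrite ltcR.
apply: filterS h => n h.
rewrite -ltcR; apply: le_lt_trans h.
have -> : complex.Im l - complex.Im (u n) = complex.Im (l - u n).
  by case: (l) (u n) => [a b] [a' b'].
exact: normIm_le.
Qed.

Lemma Re_series (u : nat -> C) n :
  complex.Re (series u n) = series (fun k => complex.Re (u k)) n.
Proof.
rewrite /series /=; elim: n => [|n IH]; first by rewrite !big_geq.
by rewrite !big_nat_recr //= -IH; case: (\sum_(_ <= _ < _) _) (u n) => [a b] [a' b'].
Qed.

Lemma Im_series (u : nat -> C) n :
  complex.Im (series u n) = series (fun k => complex.Im (u k)) n.
Proof.
rewrite /series /=; elim: n => [|n IH]; first by rewrite !big_geq.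
by rewrite !big_nat_recr //= -IH; case: (\sum_(_ <= _ < _) _) (u n) => [a b] [a' b'].
Qed.

Lemma is_cvg_series_dominated (f g : nat -> R) :
  (forall k, `|f k| <= g k) -> cvgn (series g) -> cvgn (series f).
Proof.
move=> fg cg; apply: normed_cvg; apply: series_le_cvg cg => [n|n|n] /=;
  [exact: normr_ge0| |exact: fg].
exact: le_trans (normr_ge0 _) (fg n).
Qed.

Lemma series_tail_dominated (f g : nat -> R) K :
  (forall k, `|f k| <= g k) -> cvgn (series g) ->
  `|limn (series f) - series f K| <= limn (series g) - series g K.
Proof.
move=> fg cg; have cf := is_cvg_series_dominated fg cg.
have c1 : `|series f n - series f K| @[n --> \oo] --> `|limn (series f) - series f K|.
  by apply: cvg_norm; apply: cvgB => //; exact: cvg_cst.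
have c2 : series g n - series g K @[n --> \oo] --> limn (series g) - series g K.
  by apply: cvgB => //; exact: cvg_cst.
apply: (ler_cvg_to c1 c2); near=> n.
have Kn : (K <= n)%N by near: n; exact: nbhs_infty_ge.
rewrite !sub_series_geq //.
by apply: (le_trans (ler_norm_sum _ _ _)); apply: ler_sum.
Unshelve. all: by end_near.
Qed.

Lemma tannery_real (f : nat -> nat -> R) (l g : nat -> R) :
  (forall n k, `|f n k| <= g k) -> cvgn (series g) ->
  (forall k, f n k @[n --> \oo] --> l k) ->
  cvgn (series l) /\ limn (series (f n)) @[n --> \oo] --> limn (series l).
Proof.
move=> fg cg fl.
have lg k : `|l k| <= g k.
  by apply: (cvgr_to_le (cvg_norm (fl k))); apply: nearW.
split; first exact: is_cvg_series_dominated lg cg.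
apply/cvgrPdist_lt => e e0.
have e3 : 0 < e / 3 by rewrite divr_gt0.
have [K hK] : exists K, limn (series g) - series g K < e / 3.
  have /cvgrPdist_lt/(_ _ e3) : series g @ \oo --> limn (series g) by [].
  case=> K _ /(_ K (leqnn K)) /= h; exists K.
  exact: le_lt_trans (ler_norm _) h.
have hS : series (f n) K @[n --> \oo] --> series l K.
  rewrite /series /=; elim: K {hK} => [|K IH].
    under eq_fun do rewrite big_geq //; rewrite big_geq //; exact: cvg_cst.
  under eq_fun do rewrite big_nat_recr //=; rewrite big_nat_recr //=.
  exact: cvgD.
move/cvgrPdist_lt : hS => /(_ _ e3) hS.
apply: filterS hS => n hS.
have h1 := series_tail_dominated K lg cg.
have h2 := series_tail_dominated K (fg n) cg.
have -> : limn (series l) - limn (series (f n)) =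
  (limn (series l) - series l K) + (series l K - series (f n) K)
  - (limn (series (f n)) - series (f n) K) by ring.
apply: (le_lt_trans (ler_normB _ _)).
apply: (le_lt_trans (lerD (ler_normD _ _) (lexx _))).
lra.
Qed.

(** Limits are found coordinatewise, where the completeness of the reals applies
    with the same dominating series. *)
Lemma tannery (f : nat -> nat -> C) (l : nat -> C) (g : nat -> R) :
  (forall n k, `|f n k| <= (g k)%:C) -> cvgn (series g) ->
  (forall k, f n k @[n --> \oo] --> l k) ->
  exists (S : nat -> C) (L : C),
    [/\ forall n, series (f n) @ \oo --> S n,
        S @ \oo --> L & series l @ \oo --> L].
Proof.
move=> fg cg fl.
have fgr n k : `|complex.Re (f n k)| <= g k.
  by rewrite -lecR; apply: le_trans (normRe_le _) (fg _ _).
have fgi n k : `|complex.Im (f n k)| <= g k.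
  by rewrite -lecR; apply: le_trans (normIm_le _) (fg _ _).
have [clr hr] := tannery_real fgr cg (fun k => cvg_Re _ (fl k)).
have [cli hi] := tannery_real fgi cg (fun k => cvg_Im _ (fl k)).
exists (fun n => limn (series (fun k => complex.Re (f n k))) +i*
                 limn (series (fun k => complex.Im (f n k)))).
exists (limn (series (fun k => complex.Re (l k))) +i*
        limn (series (fun k => complex.Im (l k)))).
split.
- move=> n; apply: cvg_complex => /=.
    under eq_fun do rewrite Re_series.
    exact: is_cvg_series_dominated (fgr n) cg.
  under eq_fun do rewrite Im_series.
  exact: is_cvg_series_dominated (fgi n) cg.
- exact: cvg_complex.
- apply: cvg_complex => /=.
    by under eq_fun do rewrite Re_series.
  by under eq_fun do rewrite Im_series.
Qed.

Lemma cvg_series_fin (f : nat -> C) N :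
  (forall k, (N <= k)%N -> f k = 0) -> series f @ \oo --> \sum_(k < N) f k.
Proof.
move=> f0; apply: cvg_near_cst; exists N => // n /= Nn.
rewrite /series /= (big_cat_nat (n := N)) //= big_mkord.
rewrite [X in _ + X]big_nat [X in _ + X]big1 ?addr0 // => i /andP[Ni _].
exact: f0.
Qed.

Lemma tannery_fin (f : nat -> nat -> C) (l : nat -> C) (g : nat -> R) (N : nat -> nat) :
  (forall n k, `|f n k| <= (g k)%:C) -> cvgn (series g) ->
  (forall k, f n k @[n --> \oo] --> l k) ->
  (forall n k, (N n <= k)%N -> f n k = 0) ->
  exists L : C, \sum_(k < N n) f n k @[n --> \oo] --> L /\ series l @ \oo --> L.
Proof.
move=> fg cg fl f0; have [S [L [h1 h2 h3]]] := tannery fg cg fl.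
exists L; split => //.
rewrite (_ : (fun n => _) = S) //; apply/funext => n.
apply: (cvg_unique _ _ (h1 n)); first exact: norm_hausdorff.
exact: cvg_series_fin (f0 n).
Qed.

(** Telescoping turns a product into a series, and so reduces dominated convergence
    of products to that of series. *)
Lemma prod1D_sum (K : comNzRingType) (a : nat -> K) n :
  \prod_(k < n) (1 + a k) = 1 + \sum_(k < n) a k * \prod_(j < k) (1 + a j).
Proof.
elim: n => [|n IH]; first by rewrite !big_ord0 addr0.
by rewrite !big_ord_recr /= mulrDr mulr1 {1}IH -addrA [a n * _]mulrC.
Qed.

Lemma norm_prod1D_le (a : nat -> C) (g : nat -> R) n :
  (forall k, `|a k| <= (g k)%:C) -> cvgn (series g) ->
  `|\prod_(k < n) (1 + a k)| <= (expR (limn (series g)))%:C.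
Proof.
move=> ag cg; have g0 k : 0 <= g k by rewrite -lecR; apply: le_trans (normr_ge0 _) (ag k).
apply: (@le_trans _ _ (expR (\sum_(k < n) g k))%:C); last first.
  rewrite lecR ler_expR -(big_mkord xpredT).
  apply: nondecreasing_cvgn_le => //.
  by apply/nondecreasing_seqP => m; rewrite seriesSr lerDl.
rewrite normr_prod expR_sum rmorph_prod /=; apply: ler_prod => k _.
rewrite normr_ge0 /=; apply: (le_trans (ler_normD _ _)); rewrite normr1.
apply: (le_trans (lerD (lexx 1) (ag k))).
by rewrite -[1](rmorph1 (real_complex R)) -rmorphD /= lecR expR_ge1Dx.
Qed.

(** The partial products are bounded by the exponential of the sum of the
    dominating series. *)
Lemma tannery_prod (a : nat -> nat -> C) (l : nat -> C) (g : nat -> R) (N : nat -> nat) :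
  (forall n k, `|a n k| <= (g k)%:C) -> cvgn (series g) ->
  (forall k, a n k @[n --> \oo] --> l k) ->
  (forall n k, (N n <= k)%N -> a n k = 0) ->
  exists L : C, \prod_(k < N n) (1 + a n k) @[n --> \oo] --> L /\
                \prod_(k < n) (1 + l k) @[n --> \oo] --> L.
Proof.
move=> ag cg al a0.
pose M := expR (limn (series g)).
pose f n k := a n k * \prod_(j < k) (1 + a n j).
have g0 k : 0 <= g k by rewrite -lecR; apply: le_trans (normr_ge0 _) (ag 0%N k).
have [|||n k nk|L [h1 h2]] :=
    @tannery_fin f (fun k => l k * \prod_(j < k) (1 + l j)) (fun k => M * g k) N.
- move=> n k; rewrite /f normrM mulrC [X in _ <= X]rmorphM /=.
  have h := @norm_prod1D_le (a n) g k (ag n) cg.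
  by apply: ler_pM; [exact: normr_ge0|exact: normr_ge0|exact: h|exact: ag].
- rewrite (_ : series _ = (fun n => M * series g n)); first by apply: is_cvgM => //;
  exact: is_cvg_cst.
  by apply/funext => n; rewrite /series /= mulr_sumr.
- move=> k; apply: cvgM => //; elim: k => [|k IH].
    under eq_fun do rewrite big_ord0; rewrite big_ord0; exact: cvg_cst.
  under eq_fun do rewrite big_ord_recr /=; rewrite big_ord_recr /=.
  by apply: cvgM; [exact: IH | exact: cvgD (cvg_cst _) (al k)].
- by rewrite /f a0 // mul0r.
exists (1 + L); split.
  under eq_fun do rewrite prod1D_sum.
  exact: cvgD (cvg_cst _) h1.
under eq_fun do rewrite prod1D_sum -(big_mkord xpredT (fun k => l k * \prod_(j < k) (1 +
  l j))).
exact: cvgD (cvg_cst _) h2.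
Qed.

End ComplexLimits.

(** * Real estimates for exponential, sine and cosine *)

Section RealEstimates.
Variable R : realType.

Lemma sin_le_id (v : R) : `|sin v| <= `|v|.
Proof.
wlog v0 : v / 0 <= v.
  move=> H; case: (leP 0 v) => [/H //|/ltW v0].
  by rewrite -[`|v|]normrN -[`|sin v|]normrN -sinN; apply: H; rewrite oppr_ge0.
have [|c _] := @MVT_segment R sin cos 0 v v0 (fun x _ => is_derive_sin x).
  by apply: continuous_subspaceT => x; exact: continuous_sin.
rewrite sin0 !subr0 => ->; rewrite normrM ler_piMl //; exact: cos_max.
Qed.

Lemma cos_sub1_le (v : R) : `|cos v - 1| <= v ^+ 2 / 2.
Proof.
have -> : v = (v / 2) *+ 2 by rewrite -mulr_natr; lra.
rewrite cos_mulr2n cos2sin2.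
have -> : (1 - sin (v / 2) ^+ 2) *+ 2 - 1 - 1 = - (2 * sin (v / 2) ^+ 2) by ring.
rewrite normrN ger0_norm; last by apply: mulr_ge0 => //; exact: sqr_ge0.
have h := sin_le_id (v / 2).
have : sin (v / 2) ^+ 2 <= (v / 2) ^+ 2.
  by rewrite -[sin _ ^+ 2]real_normK ?num_real // -[(v / 2) ^+ 2]real_normK ?num_real //
    ler_sqr ?nnegrE.
have -> : (v / 2 *+ 2) ^+ 2 / 2 = 2 * (v / 2) ^+ 2 by field.
by rewrite ler_pM2l.
Qed.

Lemma sin_sub_id_le (v : R) : `|v| <= 1 -> `|sin v - v| <= v ^+ 2 / 2.
Proof.
wlog v0 : v / 0 <= v.
  move=> H; case: (leP 0 v) => [/H //|/ltW v0] v1.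
  have -> : sin v - v = - (sin (- v) - (- v)) by rewrite sinN; ring.
  by rewrite -sqrrN normrN; apply: H; rewrite ?oppr_ge0 ?normrN.
rewrite ger0_norm // => v1.
have [|c /[!in_itv]/= /andP[c0 cv]] := @MVT_segment R sin cos 0 v v0 (fun x _ =>
  is_derive_sin x).
  by apply: continuous_subspaceT => x; exact: continuous_sin.
rewrite sin0 !subr0 => ->.
have -> : cos c * v - v = v * (cos c - 1) by ring.
rewrite normrM ger0_norm //; have h := cos_sub1_le c.
have h2 : c ^+ 2 <= v ^+ 2 by rewrite ler_sqr ?nnegrE.
have h3 : v ^+ 2 <= v by rewrite expr2 ler_piMl.
have -> : v ^+ 2 / 2 = v * (v / 2) by ring.
by rewrite ler_wpM2l //; lra.
Qed.

Lemma expR_sub_le (u : R) : `|u| <= 1 / 2 -> `|expR u - 1 - u| <= 2 * u ^+ 2.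
Proof.
move=> hu; have h1 := expR_ge1Dx u; have h2 := expR_ge1Dx (- u).
rewrite ger0_norm; last by lra.
have [ul uu] : - (1/2) <= u /\ u <= 1/2 by move: hu; rewrite ler_norml => /andP[].
have e0 := expR_gt0 u.
have h3 : expR u * (1 - u) <= 1.
  by have := ler_wpM2l (ltW e0) h2; rewrite expRxMexpNx_1.
have : expR u <= 1 / (1 - u) by rewrite ler_pdivlMr //; lra.
have : 1 / (1 - u) <= 1 + u + 2 * u ^+ 2.
  rewrite ler_pdivrMr; last by lra.
  have -> : (1 + u + 2 * u ^+ 2) * (1 - u) = 1 + u ^+ 2 * (1 - 2 * u) by ring.
  by rewrite lerDl mulr_ge0 ?sqr_ge0 //; lra.
lra.
Qed.

(** Doubling gives sin b = 2 cos (b/2) sin (b/2), the mean value theorem bounds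
    sin (b/2) below by (b/2) cos (pi/4), and cos (pi/4)^2 = 1/2. *)
Lemma sin_ge_half (b : R) : 0 <= b <= pi / 2 -> b / 2 <= sin b.
Proof.
move=> /andP[b0 b1].
have -> : b = (b / 2) *+ 2 by rewrite -mulr_natr; lra.
rewrite sin_mulr2n; set t := b / 2.
have t0 : 0 <= t by rewrite /t; lra.
have pi0 := pi_gt0 R.
have tp : t <= pi / 4 by rewrite /t; lra.
have cospi4 : cos (pi / 4) ^+ 2 = 1 / 2 :> R.
  have := cos_mulr2n (pi / 4 : R).
  have -> : (pi / 4 : R) *+ 2 = pi / 2 by rewrite -mulr_natr; lra.
  by rewrite cos_pihalf -mulr_natr; lra.
have c4 : 0 < cos (pi / 4) :> R by apply: cos_gt0_pihalf; lra.
have mono c : 0 <= c <= t -> cos (pi / 4) <= cos c.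
  move=> /andP[c0 ct]; rewrite leNgt ltr_cos ?in_itv /=; last 2 first.
  - by apply/andP; split; lra.
  - by apply/andP; split; lra.
  by rewrite -leNgt; lra.
have [|c /[!in_itv]/= /andP[c0 ct]] := @MVT_segment R sin cos 0 t t0 (fun x _ =>
  is_derive_sin x).
  by apply: continuous_subspaceT => x; exact: continuous_sin.
rewrite sin0 !subr0 => ->.
have h1 : cos (pi / 4) <= cos c by apply: mono; rewrite c0.
have h2 : cos (pi / 4) <= cos t by apply: mono; rewrite t0 lexx.
have h3 : 1 / 2 <= cos t * cos c.
  by rewrite -cospi4 expr2 ler_pM // ltW.
rewrite mulrA -mulr_natr -[_ *+ 2]mulr_natr.
have := ler_wpM2r t0 h3; lra.
Qed.

End RealEstimates.

(** * Complex sine and cosine *)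

Section ComplexTrig.
Variable R : realType.
Local Notation C := (CC R).

(** The complex functions are restated on the type that carries the norm topology,
    so that algebra and limits use the same structures. *)
Definition imag_unit : C := 'i%C.
Definition cexpC (z : C) : C := cexp z.
Definition csinC (z : C) : C := csin z.
Definition ccosC (z : C) : C := ccos z.

Lemma cexpD (a b : C) : cexpC (a + b) = cexpC a * cexpC b.
Proof.
rewrite /cexpC; case: a b => [a1 a2] [b1 b2]; rewrite /cexp /= expRD cosD sinD.
by apply/eqP; rewrite eq_complex /=; apply/andP; split; apply/eqP; ring.
Qed.

Lemma cexp0 : cexpC 0 = 1.
Proof.
by rewrite /cexpC /cexp /= expR0 cos0 sin0; apply/eqP; rewrite eq_complex /=; apply/andP;
  split; apply/eqP; ring.
Qed.

Lemma imag_unit_mul : imag_unit * imag_unit = -1.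
Proof. exact: (sqr_i R). Qed.

Lemma imag_unit_neq0 : imag_unit != 0.
Proof. by apply: contra_eq_neq imag_unit_mul => ->;
  rewrite mul0r eq_sym oppr_eq0 oner_eq0. Qed.

Lemma csinE z : csinC z = (cexpC (imag_unit * z) - cexpC (- (imag_unit * z))) / (2 *
  imag_unit).
Proof. by []. Qed.

Lemma ccosE z : ccosC z = (cexpC (imag_unit * z) + cexpC (- (imag_unit * z))) / 2.
Proof. by []. Qed.

Lemma csinhE z : (csinh z : C) = - imag_unit * csinC (imag_unit * z).
Proof.
have -> : (csinh z : C) = (cexpC z - cexpC (- z)) / 2 by [].
rewrite csinE (_ : imag_unit * (imag_unit * z) = - z) ?opprK;
  last by rewrite mulrA imag_unit_mul mulN1r.
by move: (cexpC _) (cexpC _) => b a; have := imag_unit_neq0; move: imag_unit => i i0;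
  field; rewrite i0.
Qed.

Lemma ccoshE z : (ccosh z : C) = ccosC (imag_unit * z).
Proof.
have -> : (ccosh z : C) = (cexpC z + cexpC (- z)) / 2 by [].
by rewrite ccosE (_ :
  imag_unit * (imag_unit * z) = - z) ?opprK 1?addrC // mulrA imag_unit_mul mulN1r.
Qed.

Lemma ccos_sqr z : ccosC z ^+ 2 = 1 - csinC z ^+ 2.
Proof.
rewrite csinE ccosE; have : cexpC (imag_unit * z) * cexpC (- (imag_unit * z)) = 1.
  by rewrite -cexpD subrr cexp0.
move: (cexpC _) (cexpC _) => b a ab; have := imag_unit_mul; have := imag_unit_neq0;
  move: imag_unit => i i0 i2.
have -> : ((a - b) / (2 * i)) ^+ 2 = (a - b) ^+ 2 / (4 * (i * i)) by field; rewrite i0.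
rewrite i2; have -> : ((a + b) / 2) ^+ 2 = (a - b) ^+ 2 / 4 + a * b by field.
by rewrite ab; field.
Qed.

Lemma csin_double z : csinC (2 * z) = 2 * csinC z * ccosC z.
Proof.
rewrite !csinE ccosE; have -> : imag_unit * (2 * z) = imag_unit * z + imag_unit * z by ring.
rewrite opprD !cexpD; move: (cexpC _) (cexpC _) => b a; have := imag_unit_neq0;
  move: imag_unit => i i0.
by field; rewrite i0.
Qed.

Lemma ccos_double z : ccosC (2 * z) = 1 - 2 * csinC z ^+ 2.
Proof.
have h := ccos_sqr z.
have -> : 1 - 2 * csinC z ^+ 2 = 2 * (1 - csinC z ^+ 2) - 1 :> C by ring.
rewrite -h !ccosE; have -> : imag_unit * (2 * z) = imag_unit * z + imag_unit * z by ring.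
have : cexpC (imag_unit * z) * cexpC (- (imag_unit * z)) = 1.
  by rewrite -cexpD subrr cexp0.
rewrite opprD !cexpD; move: (cexpC _) (cexpC _) => b a ab.
have -> : 2 * ((a + b) / 2) ^+ 2 - 1 = (a * a + b * b) / 2 + a * b - 1 by field.
by rewrite ab; ring.
Qed.

Lemma normc_sqr (z : C) : `|z| ^+ 2 = (complex.Re z ^+ 2 + complex.Im z ^+ 2)%:C.
Proof. by rewrite add_Re2_Im2. Qed.

(** The coordinates are split along exp u - 1 - u, cos v - 1 and sin v - v, each of
    second order. *)
Lemma cexp_estimate (z : C) : `|z| <= (1 / 2)%:C -> `|cexpC z - 1 - z| <= 3 * `|z| ^+ 2.
Proof.
move=> hz; have hu := le_trans (normRe_le z) hz; have hv := le_trans (normIm_le z) hz.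
rewrite !lecR in hu hv.
rewrite normc_sqr; have -> :
  3 * (complex.Re z ^+ 2 + complex.Im z ^+ 2)%:C = (3 * (complex.Re z ^+ 2 + complex.Im z
    ^+ 2))%:C :> C.
  by rewrite rmorphM /= rmorph_nat.
apply: le_trans (norm_le_ReIm _) _; rewrite lecR /cexpC.
case: z hu hv {hz} => u v /= hu hv.
have -> : expR u * cos v - 0 * sin v - 1 - u = (expR u - 1 - u) * cos v + (1 + u) * (cos
  v - 1) by ring.
have -> : expR u * sin v + 0 * cos v - 0 - v = (expR u - 1) * sin v + (sin v - v) by ring.
have e1 := expR_sub_le hu; have c1 := cos_sub1_le v; have c0 := cos_max v.
have s0 := sin_le_id v; have s1 : `|sin v - v| <= v ^+ 2 / 2 by apply: sin_sub_id_le; lra.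
have u2 : u ^+ 2 = `|u| ^+ 2 by rewrite real_normK ?num_real.
have v2 : v ^+ 2 = `|v| ^+ 2 by rewrite real_normK ?num_real.
have hu1 : `|1 + u| <= 2 by apply: le_trans (ler_normD _ _) _; rewrite normr1; lra.
have e2 : `|expR u - 1| <= 2 * `|u|.
  have -> : expR u - 1 = (expR u - 1 - u) + u by ring.
  apply: le_trans (ler_normD _ _) _.
  have : `|u| ^+ 2 <= 1 / 2 * `|u| by rewrite expr2 ler_wpM2r.
  by move: e1; rewrite u2; lra.
apply: le_trans (lerD (ler_normD _ _) (ler_normD _ _)) _.
rewrite !normrM.
have m1 : `|expR u - 1 - u| * `|cos v| <= 2 * u ^+ 2 * 1 by apply: ler_pM.
have m2 : `|1 + u| * `|cos v - 1| <= 2 * (v ^+ 2 / 2) by apply: ler_pM.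
have m3 : `|expR u - 1| * `|sin v| <= 2 * `|u| * `|v| by apply: ler_pM.
have m4 : 2 * `|u| * `|v| <= `|u| ^+ 2 + `|v| ^+ 2.
  by rewrite -subr_ge0; have := sqr_ge0 (`|u| - `|v|); congr (0 <= _); ring.
have : 0 <= v ^+ 2 by apply: sqr_ge0.
by move: m1 m2 m3 m4; rewrite -u2 -v2; lra.
Qed.

Lemma norm_imag_unit : `|imag_unit| = 1.
Proof. by rewrite [LHS]normc_def /= expr0n expr1n add0r sqrtr1. Qed.

Lemma norm_imag_unitM (z : C) : `|imag_unit * z| = `|z|.
Proof. by rewrite normrM norm_imag_unit mul1r. Qed.

Lemma csin_estimate (z : C) : `|z| <= (1 / 2)%:C -> `|csinC z - z| <= 3 * `|z| ^+ 2.
Proof.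
move=> hz.
have h1 : `|cexpC (imag_unit * z) - 1 - imag_unit * z| <= 3 * `|z| ^+ 2.
  by rewrite -(norm_imag_unitM z); apply: cexp_estimate; rewrite norm_imag_unitM.
have h2 : `|cexpC (- (imag_unit * z)) - 1 + imag_unit * z| <= 3 * `|z| ^+ 2.
  by have := @cexp_estimate (- (imag_unit * z)); rewrite normrN norm_imag_unitM opprK;
    apply.
have -> : csinC z - z = ((cexpC (imag_unit * z) - 1 - imag_unit * z) - (cexpC (-
  (imag_unit * z)) - 1 + imag_unit * z)) / (2 * imag_unit).
  rewrite csinE; move: (cexpC _) (cexpC _) => b a; have := imag_unit_neq0;
    move: imag_unit => i i0.
  by field; rewrite i0.
rewrite normrM normfV normrM norm_imag_unit mulr1 normr_nat ler_pdivrMr //.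
apply: le_trans (ler_normB _ _) _.
by apply: le_trans (lerD h1 h2) _; rewrite mulr_natr mulr2n.
Qed.

Lemma ccos_estimate (z : C) : `|z| <= (1 / 2)%:C -> `|ccosC z - 1| <= 3 * `|z| ^+ 2.
Proof.
move=> hz.
have h1 : `|cexpC (imag_unit * z) - 1 - imag_unit * z| <= 3 * `|z| ^+ 2.
  by rewrite -(norm_imag_unitM z); apply: cexp_estimate; rewrite norm_imag_unitM.
have h2 : `|cexpC (- (imag_unit * z)) - 1 + imag_unit * z| <= 3 * `|z| ^+ 2.
  by have := @cexp_estimate (- (imag_unit * z)); rewrite normrN norm_imag_unitM opprK;
    apply.
have -> : ccosC z - 1 = ((cexpC (imag_unit * z) - 1 - imag_unit * z) + (cexpC (-
  (imag_unit * z)) - 1 + imag_unit * z)) / 2.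
  by rewrite ccosE; move: (cexpC _) (cexpC _) => b a; field.
rewrite normrM normfV normr_nat ler_pdivrMr //.
apply: le_trans (ler_normD _ _) _.
by apply: le_trans (lerD h1 h2) _; rewrite mulr_natr mulr2n.
Qed.

End ComplexTrig.

(** * A finite product for the complex sine *)

Section SineProduct.
Variable R : realType.
Local Notation C := (CC R).

Lemma cvg_real_complex (T : Type) (F : set_system T) (FF : Filter F) (u : T -> R) (l : R) :
  u @ F --> l -> ((u n)%:C : C) @[n --> F] --> (l%:C : C).
Proof. by move=> ul; apply: cvg_complex => //=; exact: cvg_cst. Qed.

Lemma csin_ratio_cvg : csinC w / w @[w --> (0 : C)^'] --> (1 : C).
Proof.
apply/cvgrPdist_lt => e e0; near=> w.
have w0 : w != 0 by near: w; exact: nbhs_dnbhs_neq.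
have nw : 0 < `|w| by rewrite normr_gt0.
have w1 : `|w| < (1 / 2)%:C by near: w; apply: dnbhs0_lt; rewrite ltcR; lra.
have w2 : `|w| < e / 3 by near: w; apply: dnbhs0_lt; rewrite divr_gt0.
have -> : 1 - csinC w / w = - ((csinC w - w) / w) by field.
rewrite normrN normrM normfV ltr_pdivrMr //.
apply: le_lt_trans (csin_estimate (ltW w1)) _.
rewrite expr2 mulrA ltr_pM2r // mulrC -ltr_pdivlMr //.
Unshelve. all: by end_near.
Qed.

Lemma ccos_cvg : ccosC w @[w --> (0 : C)^'] --> (1 : C).
Proof.
apply/cvgrPdist_lt => e e0; near=> w.
have w0 : w != 0 by near: w; exact: nbhs_dnbhs_neq.
have nw : 0 < `|w| by rewrite normr_gt0.
have w1 : `|w| < (1 / 2)%:C by near: w; apply: dnbhs0_lt; rewrite ltcR; lra.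
have w2 : `|w| < e / 3 by near: w; apply: dnbhs0_lt; rewrite divr_gt0.
rewrite -normrN opprB.
apply: le_lt_trans (ccos_estimate (ltW w1)) _.
have w3 : `|w| <= 1.
  by apply: le_trans (ltW w1) _; rewrite (_ : 1 = (1 : R)%:C :> C) // lecR; lra.
apply: (@le_lt_trans _ _ (3 * `|w|)).
  by rewrite ler_pM2l // expr2 ler_piMl.
by rewrite mulrC -ltr_pdivlMr.
Unshelve. all: by end_near.
Qed.

Lemma cvg_half_pow (y : C) : y / 2 ^+ n.+1 @[n --> \oo] --> (0 : C).
Proof.
have h : (1 / 2 : R) ^+ n.+1 @[n --> \oo] --> (0 : R).
  have -> : (fun n => (1 / 2 : R) ^+ n.+1) = geometric (1 / 2) (1 / 2).
    by apply/funext => n /=; rewrite exprS.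
  by apply: cvg_geometric; rewrite ger0_norm; lra.
have -> : (fun n => y / 2 ^+ n.+1) = (fun n => y * (((1 / 2 : R) ^+ n.+1)%:C : C)).
  apply/funext => n; congr (_ * _).
  by rewrite rmorphXn /= rmorphM /= fmorphV rmorph1 rmorph_nat mul1r exprVn.
rewrite -[X in _ --> X](mulr0 y).
by apply: cvgM; [exact: cvg_cst | exact: (cvg_real_complex _ h)].
Qed.

Lemma cvg_dnbhs0 (u : nat -> C) : (forall n, u n != 0) ->
  u @ \oo --> (0 : C) -> u @ \oo --> (0 : C)^'.
Proof.
move=> u0 ul P; rewrite /dnbhs /within /= => hP; have := ul _ hP; rewrite /nbhs /=.
by apply: filterS => n /= h; exact: h (u0 n).
Qed.

Lemma csin0 : csinC (0 : C) = 0.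
Proof. by rewrite csinE mulr0 oppr0 subrr mul0r. Qed.

Lemma csin_scaled_cvg (y : C) : 2 ^+ n.+1 * csinC (y / 2 ^+ n.+1) @[n --> \oo] --> y.
Proof.
have p0 n : (2 : C) ^+ n != 0 by rewrite expf_neq0 // pnatr_eq0.
have [->|y0] := eqVneq y 0.
  under eq_fun do rewrite mul0r csin0 mulr0; exact: cvg_cst.
have h : y / 2 ^+ n.+1 @[n --> \oo] --> (0 : C)^'.
  by apply: cvg_dnbhs0 => [n|]; [rewrite mulf_neq0 ?invr_eq0|exact: cvg_half_pow].
have -> : (fun n => 2 ^+ n.+1 * csinC (y / 2 ^+ n.+1)) =
   (fun n => y * (csinC (y / 2 ^+ n.+1) / (y / 2 ^+ n.+1))).
  apply/funext => n; move: (csinC _) => a; move: (2 ^+ n.+1) (p0 n.+1) => b b0.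
  by field; rewrite ?b0 ?y0.
rewrite -[X in _ --> X]mulr1.
by apply: cvgM; [exact: cvg_cst | exact: (cvg_comp _ _ h csin_ratio_cvg)].
Qed.

Lemma ccos_scaled_cvg (y : C) : ccosC (y / 2 ^+ n.+1) @[n --> \oo] --> (1 : C).
Proof.
have p0 n : (2 : C) ^+ n != 0 by rewrite expf_neq0 // pnatr_eq0.
have [->|y0] := eqVneq y 0.
  under eq_fun do rewrite mul0r ccosE mulr0 oppr0 cexp0.
  rewrite (_ : (1 + 1) / 2 = 1) ?divff //; exact: cvg_cst.
have h : y / 2 ^+ n.+1 @[n --> \oo] --> (0 : C)^'.
  by apply: cvg_dnbhs0 => [n|]; [rewrite mulf_neq0 ?invr_eq0|exact: cvg_half_pow].
exact: (cvg_comp _ _ h ccos_cvg).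
Qed.

Lemma csin_real (x : R) : csinC (x%:C) = (sin x)%:C.
Proof.
have e1 : cexpC (imag_unit R * x%:C) = (cos x)%:C + imag_unit R * (sin x)%:C.
  rewrite /cexpC /cexp /imag_unit; apply/eqP; rewrite eq_complex /=.
  by rewrite !(mul0r, mul1r, mulr0, subr0, addr0, add0r, oppr0) expR0 !mul1r !eqxx.
have e2 : cexpC (- (imag_unit R * x%:C)) = (cos x)%:C - imag_unit R * (sin x)%:C.
  rewrite /cexpC /cexp /imag_unit; apply/eqP; rewrite eq_complex /=.
  by rewrite !(mul0r, mul1r, mulr0, subr0, addr0, add0r, oppr0) expR0 !mul1r cosN sinN
    !eqxx.
rewrite csinE e1 e2; have := imag_unit_neq0 R; move: (imag_unit R) => i i0.
by field.
Qed.

Definition angle (n m : nat) : R := m%:R * pi / 2 ^+ n.+1.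

(** With s = sin^2 t this is the factor of sin (2^(n+1) t) that carries the zeros other
    than those of sin t and cos t. *)
Definition sine_prod (n : nat) (s : C) : C :=
  \prod_(1 <= m < 2 ^ n) (1 - s / ((sin (angle n m))%:C : C) ^+ 2).

Lemma angle_bounds n m : (0 < m < 2 ^ n)%N -> 0 < angle n m < pi / 2.
Proof.
move=> /andP[m0 mn]; have p := pi_gt0 R.
have h2 : 0 < 2 ^+ n.+1 :> R by rewrite exprn_gt0.
rewrite /angle divr_gt0 ?mulr_gt0 ?ltr0n //=.
rewrite ltr_pdivrMr // exprS mulrA divfK // [X in _ < X]mulrC ltr_pM2r //.
by rewrite -natrX ltr_nat.
Qed.

(** The substitution s -> 4 s (1 - s) is the effect of t -> 2t on s = sin^2 t. Each
    factor splits in two, at an angle b and at pi/2 - b, and the factor 1 - 2 s is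
    the one at the middle angle pi/4. *)
Lemma sine_prod_double n (s : C) :
  sine_prod n.+1 s = sine_prod n (4 * s * (1 - s)) * (1 - 2 * s).
Proof.
rewrite /sine_prod.
have h1 : (1 <= 2 ^ n)%N by rewrite expn_gt0.
have h2 : (2 ^ n.+1 = 2 ^ n + 2 ^ n)%N by rewrite expnS mul2n addnn.
rewrite (big_cat_nat (n := 2 ^ n)) //=; last by rewrite h2 leq_addr.
rewrite [X in _ * X]big_ltn; last by rewrite h2; lia.
rewrite [X in _ * (_ * X)]big_nat_rev /=.
rewrite [X in _ * (_ * X)](big_addn 1 (2 ^ n.+1) (2 ^ n)).
have -> : (2 ^ n.+1 - 2 ^ n = 2 ^ n)%N by rewrite h2 addnK.
rewrite mulrCA mulrC -big_split /=; congr (_ * _); last first.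
  rewrite (_ : angle n.+1 (2 ^ n) = pi / 4); last first.
    rewrite /angle natrX !exprS; have : 2 ^+ n != 0 :> R by rewrite expf_neq0 // pnatr_eq0.
    by move: (2 ^+ n) => a a0; field.
  have : (sin (pi / 4)) ^+ 2 = 1 / 2 :> R.
    have := cos_mulr2n (pi / 4 : R).
    have -> : (pi / 4 : R) *+ 2 = pi / 2 by rewrite -mulr_natr; lra.
    by rewrite cos_pihalf cos2sin2 -mulr_natr; lra.
  rewrite -rmorphXn /= => ->.
  have -> : ((1 / 2 : R)%:C : C) = 1 / 2 by rewrite rmorphM /= fmorphV rmorph1 rmorph_nat.
  by rewrite div1r invrK [s * _]mulrC.
rewrite !big_nat; apply: eq_bigr => m mn.
have mn' : (0 < m < 2 ^ n.+1)%N by case/andP: mn => m0 mn;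
  rewrite m0 h2 (leq_trans mn) ?leq_addr.
have -> : ((2 ^ n).+1 + 2 ^ n.+1 - (m + 2 ^ n).+1 = 2 ^ n.+1 - m)%N by lia.
have -> : angle n.+1 (2 ^ n.+1 - m) = pi / 2 - angle n.+1 m.
  rewrite /angle natrB; last by case/andP: mn' => _ /ltnW.
  rewrite natrX [2 ^+ n.+2]exprS;
    have : 2 ^+ n.+1 != 0 :> R by rewrite expf_neq0 // pnatr_eq0.
  by move: (2 ^+ n.+1) => a a0; field.
have -> : angle n m = angle n.+1 m *+ 2.
  rewrite /angle [2 ^+ n.+2]exprS;
    have : 2 ^+ n.+1 != 0 :> R by rewrite expf_neq0 // pnatr_eq0.
  by move: (2 ^+ n.+1) => a a0; rewrite -mulr_natr; field.
have /andP[b0 b1] := angle_bounds mn'; move: (angle n.+1 m) b0 b1 => b b0 b1.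
rewrite -[pi / 2 - b]opprB sinN sinBpihalf opprK sin_mulr2n.
have sb : sin b != 0 by rewrite gt_eqF // sin_gt0_pihalf // b0.
have cb : cos b != 0 by rewrite gt_eqF // cos_gt0_pihalf // b1 andbT; lra.
have sc : ((sin b)%:C : C) ^+ 2 + ((cos b)%:C : C) ^+ 2 = 1.
  by rewrite -!rmorphXn -rmorphD /= addrC cos2Dsin2.
have -> : ((cos b * sin b *+ 2)%:C : C) = 2 * (sin b)%:C * (cos b)%:C.
  by rewrite -mulr_natr !rmorphM /= rmorph_nat; ring.
have {}sb : ((sin b)%:C : C) != 0
  by rewrite -(rmorph0 (real_complex R)) (inj_eq (@complexI R)).
have {}cb : ((cos b)%:C : C) != 0
  by rewrite -(rmorph0 (real_complex R)) (inj_eq (@complexI R)).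
move: ((sin b)%:C : C) ((cos b)%:C : C) sc sb cb => S T sc sb cb.
have -> : (1 - s / S ^+ 2) * (1 - s / T ^+ 2) =
  1 - s * (S ^+ 2 + T ^+ 2 - s) / (S ^+ 2 * T ^+ 2) by field; rewrite sb cb.
by rewrite sc; field; rewrite sb cb.
Qed.

Lemma csin_finite_prod n (t : C) :
  csinC (2 ^+ n.+1 * t) = 2 ^+ n.+1 * csinC t * ccosC t * sine_prod n (csinC t ^+ 2).
Proof.
elim: n t => [|n IH] t.
  by rewrite /sine_prod expn0 big_geq // mulr1 expr1 csin_double.
rewrite exprSr -mulrA IH csin_double ccos_double sine_prod_double.
have -> : (2 * csinC t * ccosC t) ^+ 2 = 4 * csinC t ^+ 2 * (1 - csinC t ^+ 2).
  by rewrite -ccos_sqr; ring.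
ring.
Qed.

End SineProduct.

(** * The infinite product for the complex sine *)

Section SineInfinite.
Variable R : realType.
Local Notation C := (CC R).

Lemma is_cvg_series_mull (c : R) (f : nat -> R) :
  cvgn (series f) -> cvgn (series (fun k => c * f k)).
Proof.
move=> cf; rewrite (_ : series _ = (fun n => c * series f n)).
  by apply: is_cvgM => //; exact: is_cvg_cst.
by apply/funext => n; rewrite /series /= mulr_sumr.
Qed.

Lemma is_cvg_series_inv_sqr : cvgn (series (fun k => (k.+1%:R ^+ 2)^-1 : R)).
Proof.
apply: nondecreasing_is_cvgn.
  by apply/nondecreasing_seqP => n; rewrite seriesSr lerDl invr_ge0 exprn_ge0.
exists 2 => _ [n _ <-].
have -> : series (fun k => (k.+1%:R ^+ 2)^-1 : R) n = zeta_trunc R [:: 2%N] n.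
  by rewrite /series /= big_add1 /=; apply: eq_bigr => k _; rewrite mulr1.
case: n => [|n]; first by rewrite zeta_trunc0.
exact: le_trans (zeta_trunc2_le R n) (trunc_bound_le2 R _).
Qed.

Lemma cvg_bounded (u : nat -> C) (l : C) : u @ \oo --> l ->
  exists2 M : R, 0 <= M & forall n, `|u n| <= M%:C.
Proof.
move=> ul; have /cvg_seq_bounded/pinfty_ex_gt0[M M0 uM] : cvgn u by apply/cvg_ex; exists l.
have [M' MM'] : exists M', M = M'%:C by apply/complex_realP/gtr0_real.
by exists M' => [|n]; [rewrite -lecR -MM'; exact: ltW | rewrite -MM'; exact: uM].
Qed.

Lemma sin_angle_scaled_cvg (m : nat) :
  (2 ^+ n.+1 * ((sin (angle R n m))%:C : C)) @[n --> \oo] --> ((m%:R * pi : R)%:C : C).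
Proof.
have := @csin_scaled_cvg R ((m%:R * pi : R)%:C : C).
rewrite (_ : (fun n => _) = (fun n => 2 ^+ n.+1 * ((sin (angle R n m))%:C : C))) //.
apply/funext => n; congr (_ * _); rewrite -csin_real; congr csinC.
by rewrite /angle [RHS]rmorphM fmorphV rmorphXn /= rmorph_nat.
Qed.

(** The factors at level n are dominated by a multiple of 1/k^2 because
    2^(n+1) sin (y / 2^(n+1)) is bounded and sin b >= b/2 at the real angles. *)
Lemma csin_product (y : C) :
  y * \prod_(k < n) (1 - (y / (k.+1%:R * (pi : R)%:C)) ^+ 2) @[n --> \oo] --> csinC y.
Proof.
have p0 n : (2 : C) ^+ n != 0 by rewrite expf_neq0 // pnatr_eq0.
pose q n : C := 2 ^+ n.+1 * csinC (y / 2 ^+ n.+1).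
have hq : q @ \oo --> y := @csin_scaled_cvg R y.
have [M M0 hM] := cvg_bounded hq.
pose r n k : C := 2 ^+ n.+1 * (sin (angle R n k.+1))%:C.
pose N n := (2 ^ n).-1.
pose a n k : C := if (k < N n)%N then - (q n / r n k) ^+ 2 else 0.
pose l k : C := - (y / (k.+1%:R * (pi : R)%:C)) ^+ 2.
(* From |2^(n+1) sin (y / 2^(n+1))| <= M and 2^(n+1) sin b >= (k+1) pi / 2. *)
pose g k : R := 4 * M ^+ 2 / pi ^+ 2 * (k.+1%:R ^+ 2)^-1.
have pi0 := pi_gt0 R.
have [||||L [h1 h2]] := @tannery_prod R a l g N.
- move=> n k; rewrite /a; case: ifPn => [kN|_]; last first.
    rewrite normr0 -(rmorph0 (real_complex R)) lecR mulr_ge0 ?invr_ge0 ?exprn_ge0 //.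
    by rewrite mulr_ge0 ?invr_ge0 ?exprn_ge0 ?mulr_ge0 ?exprn_ge0 // ltW.
  have kb : (0 < k.+1 < 2 ^ n)%N by move: kN; rewrite /N; have := expn_gt0 2 n; lia.
  have /andP[b0 b1] := angle_bounds R kb.
  have hs : angle R n k.+1 / 2 <= sin (angle R n k.+1) by apply: sin_ge_half; rewrite !ltW.
  have hr : (k.+1%:R * pi / 2 : R)%:C <= `|r n k|.
    rewrite /r normrM normrX normr_nat.
    have -> : (2 ^+ n.+1 : C) = (2 ^+ n.+1 : R)%:C by rewrite rmorphXn /= rmorph_nat.
    have -> : `|(sin (angle R n k.+1))%:C : C| = (sin (angle R n k.+1))%:C.
      by rewrite ger0_norm // -(rmorph0 (real_complex R)) lecR; apply: le_trans hs; lra.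
    rewrite -rmorphM lecR /=; apply: le_trans (ler_wpM2l _ hs); last by rewrite exprn_ge0.
    have : 2 ^+ n.+1 != 0 :> R by rewrite expf_neq0 // pnatr_eq0.
    rewrite /angle; move: (2 ^+ n.+1) => b bn0; by rewrite le_eqVlt; apply/orP; left;
      apply/eqP; field.
  have hqr : `|q n / r n k| <= (M / (k.+1%:R * pi / 2))%:C.
    have d0 : 0 < k.+1%:R * pi / 2 :> R by rewrite divr_gt0 ?mulr_gt0.
    rewrite normrM normfV rmorphM fmorphV /=.
    apply: ler_pM; [exact: normr_ge0|by rewrite invr_ge0|exact: hM|].
    have d0' : 0 < (k.+1%:R * pi / 2 : R)%:C :> C
      by rewrite -(rmorph0 (real_complex R)) ltcR.
    by rewrite lef_pV2 ?posrE // (lt_le_trans d0' hr).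
  rewrite normrN normrX.
  have -> : g k = (M / (k.+1%:R * pi / 2)) ^+ 2.
    have k0 : k.+1%:R != 0 :> R by rewrite pnatr_eq0.
    have pin0 : pi != 0 :> R by rewrite gt_eqF.
    by rewrite /g; move: (k.+1%:R) (pi : R) k0 pin0 => m p m0 pn0; field; rewrite m0 pn0.
  by rewrite rmorphXn /= lerXn2r // nnegrE (le_trans _ hqr).
- by apply: is_cvg_series_mull; exact: is_cvg_series_inv_sqr.
- move=> k.
  have h0 : ((k.+1%:R * pi : R)%:C : C) != 0.
    by rewrite -(rmorph0 (real_complex R)) (inj_eq (@complexI R)) gt_eqF // mulr_gt0.
  have -> : l k = - (y / (k.+1%:R * pi : R)%:C) ^+ 2 by rewrite /l rmorphM /= rmorph_nat.
  apply: (@cvg_trans _ ((fun n => - (q n / r n k) ^+ 2) @ \oo)).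
    apply: near_eq_cvg; exists k.+2 => // n /= kn; rewrite /a ifT //.
    by rewrite /N; have := ltn_expl n (isT : (1 < 2)%N); lia.
  apply: cvgN; rewrite expr2; under eq_fun do rewrite expr2.
  have hqr : q n / r n k @[n --> \oo] --> y / (k.+1%:R * pi : R)%:C.
    have hr : r n k @[n --> \oo] --> ((k.+1%:R * pi : R)%:C : C).
      exact: (@sin_angle_scaled_cvg k.+1).
    exact: (cvgM hq (cvgV h0 hr)).
  exact: (cvgM hqr hqr).
- by move=> n k nk; rewrite /a ltnNge nk.
have hc : (fun n => q n * ccosC (y / 2 ^+ n.+1) * \prod_(k < N n) (1 + a n k)) = fun=>
  csinC y.
  apply/funext => n; have -> : csinC y = csinC (2 ^+ n.+1 * (y / 2 ^+ n.+1)).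
    by rewrite mulrCA divff ?mulr1.
  rewrite csin_finite_prod; congr (_ * _).
  rewrite /sine_prod big_add1 big_mkord; apply: eq_bigr => k _.
  rewrite /a ltn_ord /q /r; congr (1 - _).
  by rewrite -mulf_div divff // mul1r expr_div_n.
have : (fun n => q n * ccosC (y / 2 ^+ n.+1) * \prod_(k < N n) (1 + a n k)) @ \oo --> y *
  1 * L.
  exact: (cvgM (cvgM hq (@ccos_scaled_cvg R y)) h1).
rewrite hc mulr1 => hy.
have -> : csinC y = y * L by apply: (cvg_unique _ (@cvg_cst _ _ _ _ _) hy);
  exact: norm_hausdorff.
exact: (cvgM (cvg_cst y) h2).
Qed.

End SineInfinite.

(** * Limit of the explicit solution *)

Section SolutionLimit.
Variable R : realType.
Local Notation C := (CC R).

Lemma cvg_subseq (T : topologicalType) (u : nat -> T) (l : T) (phi : nat -> nat) :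
  (forall n, n <= phi n)%N -> u @ \oo --> l -> (u \o phi) @ \oo --> l.
Proof.
move=> hphi ul; apply: (cvg_comp _ _ _ ul) => P [N _ NP].
by exists N => // n /= Nn; apply: NP => /=; exact: leq_trans (hphi n).
Qed.

Lemma binom_ratio_bounds n k : 0 <= binom_ratio R n k <= 1.
Proof.
have [kn|nk] := leqP k n; last by rewrite binom_ratio_small // lexx ler01.
have h (i : 'I_k) : 0 <= ((n%:R - i%:R) / (n + i.+1)%:R : R) <= 1.
  have ikn : (i <= n)%N := leq_trans (ltnW (ltn_ord i)) kn.
  rewrite -natrB // divr_ge0 //= ler_pdivrMr ?ltr0n ?addnS //.
  by rewrite mul1r ler_nat; lia.
rewrite /binom_ratio prodr_ge0 /=; last by move=> i _; case/andP: (h i).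
rewrite [X in _ <= X](_ : 1 = \prod_(i < k) (1 : R)); last by rewrite big1.
by apply: ler_prod => i _; exact: h.
Qed.

Lemma binom_ratio_cvg k : binom_ratio R n k @[n --> \oo] --> (1 : R).
Proof.
elim: k => [|k IH].
  rewrite (_ : (fun n => _) = fun=> 1); first exact: cvg_cst.
  by apply/funext => n; rewrite /binom_ratio big_ord0.
rewrite (_ : (fun n => _) = (fun n => binom_ratio R n k * ((n%:R - k%:R) / (n +
  k.+1)%:R))); last first.
  by apply/funext => n; rewrite /binom_ratio big_ord_recr.
have h : (n%:R - k%:R) / (n + k.+1)%:R @[n --> \oo] --> (1 : R).
  apply/cvgrPdist_le => e e0.
  have /cvgrPdist_le/(_ _ (divr_gt0 e0 (ltr0Sn R (2 * k)))) := @cvg_harmonic R.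
  apply: filterS => n; rewrite sub0r normrN /harmonic /= ger0_norm ?invr_ge0 //.
  rewrite ler_pdivlMr // => h.
  have nk : (n + k.+1)%:R != 0 :> R by rewrite pnatr_eq0 addnS.
  have -> : 1 - (n%:R - k%:R) / (n + k.+1)%:R = (2 * k).+1%:R / (n + k.+1)%:R :> R.
    have -> : (2 * k).+1%:R = (n + k.+1)%:R - (n%:R - k%:R) :> R.
      by rewrite natrD -!natr1 natrM; ring.
    by rewrite [RHS]mulrBl divff.
  rewrite ger0_norm ?divr_ge0 //; apply: le_trans h; rewrite [X in _ <= X]mulrC.
  by rewrite ler_wpM2l // lef_pV2 ?posrE // ?ltr0n ?ler_nat ?addnS // ltnS leq_addr.
rewrite -[X in _ --> X](mulr1 (1 : R)); exact: (cvgM IH h).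
Qed.

Lemma binom_ratio_complex n k : binom_ratio C n k = (binom_ratio R n k)%:C.
Proof.
rewrite /binom_ratio rmorph_prod; apply: eq_bigr => i _.
by rewrite rmorphM fmorphV rmorphB !rmorph_nat.
Qed.

Section Disc.
Variable x : C.
Hypothesis hx : `|x| < 1.

Lemma sub_alt_neq0 i : i.+1%:R ^+ 2 - (-1) ^+ i.+1 * x != 0.
Proof.
rewrite subr_eq0; apply: contraTneq hx => h.
have : `|i.+1%:R ^+ 2 : C| = `|x| by rewrite h normrM normrX normrN1 expr1n mul1r.
rewrite -natrX normr_nat => <-; rewrite le_gtF //.
by rewrite -[1]/(1%:R) ler_nat expn_gt0.
Qed.

Definition alt_coef (i : nat) : C :=
  2 * ((-1) ^+ i.+1 * x) / (i.+1%:R ^+ 2 - (-1) ^+ i.+1 * x).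

Lemma alt_prodE n : alt_prod x n = \prod_(k < n) (1 + alt_coef k).
Proof.
apply: eq_bigr => k _; rewrite /alt_coef; have := sub_alt_neq0 k.
by move: (_ * x) (_ ^+ 2) => e m h; field.
Qed.

(** The hypothesis |x| < 1 keeps the denominators above (1 - |x|) i^2. *)
Lemma alt_coef_le :
  exists c : R, forall i, `|alt_coef i| <= (c * (i.+1%:R ^+ 2)^-1)%:C.
Proof.
have [r xr] : exists r, `|x| = r%:C by apply/complex_realP; exact: normr_real.
have r0 : 0 <= r by rewrite -lecR -xr; exact: normr_ge0.
have r1 : r < 1 by rewrite -ltcR -xr.
exists (2 * r / (1 - r)) => i.
have m1 : 1 <= i.+1%:R ^+ 2 :> R by rewrite -natrX -[1]/(1%:R) ler_nat expn_gt0.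
have norm_e : `|(-1) ^+ i.+1 * x| = r%:C by rewrite normrM normrX normrN1 expr1n mul1r.
have hd : ((1 - r) * i.+1%:R ^+ 2 : R)%:C <= `|i.+1%:R ^+ 2 - (-1) ^+ i.+1 * x|.
  apply: (@le_trans _ _ (`|i.+1%:R ^+ 2 : C| - `|(-1) ^+ i.+1 * x|)); last exact: lerB_dist.
  rewrite norm_e normrX normr_nat.
  have -> : (i.+1%:R ^+ 2 : C) = (i.+1%:R ^+ 2 : R)%:C by rewrite rmorphXn /= rmorph_nat.
  rewrite -rmorphB lecR; move: m1; move: (i.+1%:R ^+ 2 : R) => m m1.
  by rewrite mulrBl mul1r lerB // ler_peMr.
rewrite /alt_coef normrM normfV normrM norm_e normr_nat.
have d0 : 0 < (1 - r) * i.+1%:R ^+ 2 :> R by rewrite mulr_gt0 ?exprn_gt0 ?subr_gt0.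
have -> : (2 * r / (1 - r) / i.+1%:R ^+ 2)%:C = (2 * r)%:C * (((1 - r) * i.+1%:R ^+ 2 :
  R)%:C)^-1 :> C.
  by rewrite -fmorphV -[RHS]rmorphM /=; move: (_ ^+ 2) => m; rewrite invfM mulrA.
have d0' : 0 < ((1 - r) * i.+1%:R ^+ 2 : R)%:C :> C
  by rewrite -(rmorph0 (real_complex R)) ltcR.
have -> : 2 * r%:C = (2 * r)%:C :> C by rewrite rmorphM /= rmorph_nat.
apply: ler_wpM2l; first by rewrite -(rmorph0 (real_complex R)) lecR mulr_ge0.
by rewrite lef_pV2 ?posrE // (lt_le_trans d0' hd).
Qed.

(** The weights p(n,k) lie between 0 and 1 and tend to 1, and the increments of W
    are summable, so the limit of D_n is the sum of the increments of W. *)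
Lemma solution_even_cvg : exists W : C,
  solution_even x @ \oo --> W /\ alt_prod x @ \oo --> W.
Proof.
have [c hc] := alt_coef_le.
pose g (k : nat) : R := c * (k.+1%:R ^+ 2)^-1.
have cg : cvgn (series g) by apply: is_cvg_series_mull; exact: is_cvg_series_inv_sqr.
pose M := expR (limn (series g)).
pose f n k : C := binom_ratio C n k.+1 * (alt_prod x k.+1 - alt_prod x k).
have [|||n k nk|L [h1 h2]] :=
  @tannery_fin R f (fun k => alt_prod x k.+1 - alt_prod x k) (fun k => M * g k) (fun n =>
    n).
- move=> n k; rewrite /f normrM.
  have -> : alt_prod x k.+1 - alt_prod x k = alt_prod x k * alt_coef k.
    by rewrite !alt_prodE big_ord_recr /= mulrDr mulr1 addrAC subrr add0r.
  have b1 : `|binom_ratio C n k.+1| <= 1.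
    have /andP[br0 br1] := binom_ratio_bounds n k.+1.
    rewrite binom_ratio_complex ger0_norm; last by rewrite -(rmorph0 (real_complex R)) lecR.
    by rewrite -(rmorph1 (real_complex R)) lecR.
  apply: (@le_trans _ _ (1 * `|alt_prod x k * alt_coef k|)); first by rewrite ler_wpM2r.
  rewrite mul1r normrM [X in _ <= X]rmorphM /=.
  apply: ler_pM; [exact: normr_ge0|exact: normr_ge0| |exact: hc].
  by rewrite alt_prodE; exact: (@norm_prod1D_le R alt_coef g k hc cg).
- by apply: is_cvg_series_mull; exact: cg.
- move=> k; have hb : binom_ratio C n k.+1 @[n --> \oo] --> (1 : C).
    under eq_fun do rewrite binom_ratio_complex;
      exact: (cvg_real_complex _ (binom_ratio_cvg _)).
  rewrite -[X in _ --> X](mul1r (alt_prod x k.+1 - alt_prod x k)).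
  exact: (cvgM hb (cvg_cst _)).
- by rewrite /f binom_ratio_small ?mul0r.
exists (1 + L); split.
  rewrite (_ : solution_even x = (fun n => 1 + \sum_(k < n) f n k)); last by [].
  exact: (cvgD (cvg_cst (1 : C)) h1).
have -> : alt_prod x = (fun n => 1 + series (fun k => alt_prod x k.+1 - alt_prod x k) n).
  apply/funext => n; rewrite /series /= telescope_sumr // /alt_prod big_ord0.
  by rewrite addrC subrK.
exact: (cvgD (cvg_cst (1 : C)) h2).
Qed.

End Disc.

(** * The limit product as a quotient of sine products *)

Definition sq_prod (u : C) n : C := \prod_(k < n) (1 - u / k.+1%:R ^+ 2).

Lemma sq_prod_neq0 u n : `|u| < 1 -> sq_prod u n != 0.
Proof.
move=> hu; apply/prodf_neq0 => k _; rewrite subr_eq0; apply: contraTneq hu => h.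
have k0 : k.+1%:R ^+ 2 != 0 :> C by rewrite expf_neq0 // pnatr_eq0.
have -> : u = k.+1%:R ^+ 2 by rewrite -[LHS](divfK k0) -h mul1r.
by rewrite -natrX normr_nat le_gtF // -[1]/(1%:R) ler_nat expn_gt0.
Qed.

Lemma alt_prod_step (K : numFieldType) (x i m P P' Q Q' : K) :
  i != 0 -> m != 0 -> P' != 0 -> Q != 0 ->
  i ^+ 2 + x != 0 -> (2 * m) ^+ 2 + x != 0 -> (2 * m) ^+ 2 - x != 0 ->
  P / P' * (Q' / Q) ^+ 2 * ((i ^+ 2 - x) / (i ^+ 2 + x))
    * (((2 * m) ^+ 2 + x) / ((2 * m) ^+ 2 - x))
  = P * (1 - x / i ^+ 2) * (1 - x / (2 * m) ^+ 2)
    / (P' * (1 - - x / i ^+ 2) * (1 - - x / (2 * m) ^+ 2))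
    * ((Q' * (1 - - x / 4 / m ^+ 2)) / (Q * (1 - x / 4 / m ^+ 2))) ^+ 2.
Proof.
move=> i0 m0 P0 Q0 h1 h2 h3.
have e1 : 1 - - x / i ^+ 2 = (i ^+ 2 + x) / i ^+ 2 by field.
have e2 : 1 - - x / (2 * m) ^+ 2 = ((2 * m) ^+ 2 + x) / (2 * m) ^+ 2 by field.
have e3 : 1 - - x / 4 / m ^+ 2 = ((2 * m) ^+ 2 + x) / (2 * m) ^+ 2 by field.
have e4 : 1 - x / 4 / m ^+ 2 = ((2 * m) ^+ 2 - x) / (2 * m) ^+ 2 by field.
have e5 : 1 - x / (2 * m) ^+ 2 = ((2 * m) ^+ 2 - x) / (2 * m) ^+ 2 by field.
have e6 : 1 - x / i ^+ 2 = (i ^+ 2 - x) / i ^+ 2 by field.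
rewrite e1 e2 e3 e4 e5 e6.
have : (2 * m) ^+ 2 != 0 by rewrite expf_neq0 // mulf_neq0 // pnatr_eq0.
have : i ^+ 2 != 0 by rewrite expf_neq0.
move: h1 h2 h3 {e1 e2 e3 e4 e5 e6}.
move: (i ^+ 2) ((2 * m) ^+ 2) => a b.
move: (a + x) (a - x) (b + x) (b - x) => ap am bp bm h1 h2 h3 a0 b0.
by field; rewrite ?P0 ?Q0 ?h1 ?h2 ?h3 ?a0 ?b0.
Qed.

(** The first quotient carries the factors of cos / cosh together with the
    inverse of those of sinh / sin; the square corrects the latter. This way only
    the sine product is needed, as sin 2y / sinh 2y contains cos y / cosh y. *)
Lemma alt_prod_even x n : `|x| < 1 ->
  alt_prod x n.*2 = sq_prod x n.*2 / sq_prod (- x) n.*2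
                    * (sq_prod (- x / 4) n / sq_prod (x / 4) n) ^+ 2.
Proof.
move=> hx.
have hx4 : `|x / 4| < 1.
  rewrite normrM normfV normr_nat ltr_pdivrMr // mul1r; apply: lt_trans hx _.
  by rewrite -[1]/(1%:R) ltr_nat.
have hNx : `|- x| < 1 by rewrite normrN.
have s1 k : (-1) ^+ k.*2 = 1 :> C by rewrite -mul2n exprM sqrrN !expr1n.
have s2 k : (-1) ^+ k.*2.+1 = -1 :> C by rewrite exprS s1 mulr1.
have s3 k : (-1) ^+ k.*2.+2 = 1 :> C by rewrite -doubleS s1.
elim: n => [|n IH].
  by rewrite /alt_prod /sq_prod !big_ord0; field.
have nz1 := @sq_prod_neq0 (- x) n.*2 hNx; have nz2 := @sq_prod_neq0 (x / 4) n hx4.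
have nz3 := sub_alt_neq0 hx n.*2.
have nz4 := sub_alt_neq0 hx n.*2.+1.
have nz5 := sub_alt_neq0 hNx n.*2.+1.
have i0 : n.*2.+1%:R != 0 :> C by rewrite pnatr_eq0.
have m0 : n.+1%:R != 0 :> C by rewrite pnatr_eq0.
have e2 : n.*2.+2%:R = 2 * n.+1%:R :> C by rewrite -doubleS -mul2n natrM.
rewrite s3 mul1r e2 in nz4; rewrite s3 mul1r opprK e2 in nz5.
rewrite s2 mulN1r opprK in nz3.
rewrite doubleS /alt_prod /sq_prod !big_ord_recr /= -!/(alt_prod _ _) -!/(sq_prod _ _).
rewrite s2 s3 mulN1r mul1r opprK e2.
rewrite [X in X * _ * _]IH; apply: alt_prod_step;
  [exact: i0|exact: m0|exact: nz1|exact: nz2|exact: nz3|exact: nz5|exact: nz4].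
Qed.

(** If sin w = 0 then exp (i w) = exp (- i w); comparing coordinates forces w to be
    a real zero of the sine, and only 0 has |Re w| < pi. *)
Lemma csin_neq0 (w : C) : w != 0 -> `|complex.Re w| < pi -> csinC w != 0.
Proof.
case: w => u v w0 /= hu; apply/eqP => h.
have h2 : cexpC (imag_unit R * (u +i* v)) = cexpC (- (imag_unit R * (u +i* v))).
  move/eqP: h; rewrite csinE mulf_eq0 invr_eq0 mulf_eq0 (negPf (imag_unit_neq0 R))
    pnatr_eq0 !orbF.
  by rewrite subr_eq0 => /eqP.
move: h2; rewrite /cexpC /cexp /imag_unit /= !(mul0r, mul1r, mulr0, add0r, sub0r, opprK,
  addr0, subr0).
rewrite cosN sinN => -[]; rewrite !mul0r !subr0 !addr0 => h1 h2.
have e1 := expR_gt0 v; have e2 := expR_gt0 (- v).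
have su : sin u = 0.
  have : (expR (- v) + expR v) * sin u = 0 by rewrite mulrDl h2; ring.
  by move/eqP; rewrite mulf_eq0 gt_eqF ?addr_gt0 //= => /eqP.
have cu : cos u != 0.
  by apply/eqP => cu; have := cos2Dsin2 u; rewrite cu su !expr0n addr0 => /eqP;
    rewrite eq_sym oner_eq0.
have v0 : v = 0.
  have : expR (- v) = expR v by apply: (mulIf cu).
  by move/expR_inj; lra.
have u0 : u = 0.
  apply/eqP; move: hu; rewrite ltr_norml => /andP[ul uu].
  case: (ltrgt0P u) => // uu0.
    by have := sin_gt0_pi (x := u); rewrite su uu0 uu ltxx => /(_ isT).
  have := sin_gt0_pi (x := - u); rewrite sinN su oppr0 oppr_gt0 uu0 ltxx /=.
  by rewrite ltrNl ul => /(_ isT).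
by move: w0; rewrite u0 v0 eqxx.
Qed.

End SolutionLimit.

Section Limits.
Variable R : realType.
Local Notation C := (CC R).
Local Notation piC := ((pi : R)%:C : C).

Lemma piC_neq0 : piC != 0.
Proof. by rewrite -(rmorph0 (real_complex R)) (inj_eq (@complexI R)) gt_eqF ?pi_gt0. Qed.

Lemma cvg_mulC (T : Type) (F : set_system T) (FF : Filter F) (u v : T -> C) (a b : C) :
  u @ F --> a -> v @ F --> b -> u x * v x @[x --> F] --> a * b.
Proof. by move=> ua vb; exact: (cvgM ua vb). Qed.

Lemma cvg_divC (T : Type) (F : set_system T) (FF : Filter F) (u v : T -> C) (a b : C) :
  b != 0 -> u @ F --> a -> v @ F --> b -> u x / v x @[x --> F] --> a / b.
Proof. by move=> b0 ua vb; exact: (cvgM ua (cvgV b0 vb)). Qed.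

Lemma sq_prod_cvg (v : C) : v != 0 ->
  sq_prod (v ^+ 2) n @[n --> \oo] --> csinC (piC * v) / (piC * v).
Proof.
move=> v0; have pv : piC * v != 0 by rewrite mulf_neq0 // piC_neq0.
have h := cvg_mulC eventually_filter (cvg_cst (piC * v)^-1) (@csin_product R (piC * v)).
rewrite mulrC; move: h.
rewrite (_ : (fun n => _ * _) = (fun n => sq_prod (v ^+ 2) n)); first exact.
apply/funext => n /=; rewrite mulKf //; apply: eq_bigr => k _.
congr (1 - _); have k0 : k.+1%:R != 0 :> C by rewrite pnatr_eq0.
have -> : piC * v / (k.+1%:R * piC) = v / k.+1%:R.
  by have := piC_neq0; move: piC (k.+1%:R : C) k0 => p m m0 p0; field; rewrite m0 p0.
by rewrite expr_div_n.
Qed.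

Lemma tanh_cotE (z : C) : let y := piC * z / 2 in
  tanh_cot z = (- imag_unit R * csinC (imag_unit R * y) / ccosC (imag_unit R * y)) *
    (ccosC y / csinC y).
Proof. by move=> y; rewrite -csinhE -ccoshE. Qed.

(** With y = pi z / 2 the four sine products give
    (sin 2y / sinh 2y) (sinh y / sin y)^2 = tanh y cot y. *)
Lemma alt_prod_cvg (z : C) : `|z| < 1 -> z != 0 ->
  forall W : C, alt_prod (z ^+ 2) @ \oo --> W -> W = tanh_cot z.
Proof.
move=> hz z0 W hW.
have hx : `|z ^+ 2| < 1 by rewrite normrX expr_lt1.
pose i := imag_unit R; have i0 : i != 0 := imag_unit_neq0 R;
  have i2 : i ^+ 2 = -1 by rewrite expr2; exact: imag_unit_mul.
have p0 := piC_neq0.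
pose y := piC * z / 2.
have y0 : y != 0 by rewrite !mulf_neq0 ?invr_eq0.
have iz0 : i * z != 0 by rewrite mulf_neq0.
have z20 : z / 2 != 0 by rewrite mulf_neq0 // invr_eq0.
have iz20 : i * z / 2 != 0 by rewrite mulf_neq0 // invr_eq0.
have e1 : piC * z = 2 * y by rewrite /y; field.
have e2 : piC * (i * z) = 2 * (i * y) by rewrite /y; field.
have e3 : piC * (z / 2) = y by rewrite /y; field.
have e4 : piC * (i * z / 2) = i * y by rewrite /y; field.
have h1 := sq_prod_cvg z0; have h2 := sq_prod_cvg iz0.
have h3 := sq_prod_cvg z20; have h4 := sq_prod_cvg iz20.
rewrite e1 in h1; rewrite e2 in h2; rewrite e3 in h3; rewrite e4 in h4.
have x2 : (i * z) ^+ 2 = - z ^+ 2 by rewrite exprMn i2 mulN1r.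
have x3 : (z / 2) ^+ 2 = z ^+ 2 / 4 by field.
have x4 : (i * z / 2) ^+ 2 = - z ^+ 2 / 4 by rewrite -x2; field.
rewrite x2 in h2; rewrite x3 in h3; rewrite x4 in h4.
have hRe (w : C) : `|w| < 1 -> `|complex.Re (piC * w)| < pi.
  move=> hw; rewrite -ltcR; apply: le_lt_trans (normRe_le _) _.
  rewrite normrM ger0_norm; last by rewrite -(rmorph0 (real_complex R)) lecR pi_ge0.
  rewrite -[X in _ < X]mulr1 ltr_pM2l //.
  by rewrite -(rmorph0 (real_complex R)) ltcR pi_gt0.
have niz : `|i * z| < 1 by rewrite norm_imag_unitM.
have nz2 : `|z / 2| < 1.
  rewrite normrM normfV normr_nat ltr_pdivrMr // mul1r; apply: lt_trans hz _.
  by rewrite -[1]/(1%:R) ltr_nat.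
have s2 : csinC (2 * (i * y)) != 0.
  by rewrite -e2; apply: csin_neq0; [rewrite mulf_neq0|exact: hRe].
have s3 : csinC y != 0 by rewrite -e3; apply: csin_neq0; [rewrite e3|exact: hRe].
have dbl n : (n <= n.*2)%N by rewrite -addnn leq_addr.
have hW2 := cvg_subseq dbl hW.
have q2 : csinC (2 * (i * y)) / (2 * (i * y)) != 0
  by rewrite mulf_neq0 // invr_eq0 !mulf_neq0.
have q3 : csinC y / y != 0 by rewrite mulf_neq0 // invr_eq0.
have k1 := cvg_subseq dbl h1; have k2 := cvg_subseq dbl h2.
have k34 := cvg_divC eventually_filter q3 h4 h3.
have kk := cvg_mulC eventually_filter (cvg_divC eventually_filter q2 k1 k2)
  (cvg_mulC eventually_filter k34 k34).
have eW : W = csinC (2 * y) / (2 * y) / (csinC (2 * (i * y)) / (2 * (i * y)))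
    * (csinC (i * y) / (i * y) / (csinC y / y) * (csinC (i * y) / (i * y) / (csinC y / y))).
  apply: (cvg_unique _ hW2); first exact: norm_hausdorff.
  rewrite (_ : _ \o _ = (fun n => sq_prod (z ^+ 2) n.*2 / sq_prod (- z ^+ 2) n.*2 *
     (sq_prod (- z ^+ 2 / 4) n / sq_prod (z ^+ 2 / 4) n
      * (sq_prod (- z ^+ 2 / 4) n / sq_prod (z ^+ 2 / 4) n)))); first exact: kk.
  by apply/funext => n /=; rewrite alt_prod_even // expr2.
rewrite eW tanh_cotE -/y -/i !csin_double.
rewrite csin_double mulf_eq0 mulf_eq0 !negb_or in s2.
case/andP: s2 => /andP[_ sT] sc.
move: (csinC y) (csinC (i * y)) (ccosC y) (ccosC (i * y)) s3 sT sc => S T c c' S0 T0 c0.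
have -> : - i = i^-1.
  by apply: (mulfI i0); rewrite divff // mulrN -expr2 i2 opprK.
by field; rewrite i0 S0 T0 c0 y0.
Qed.

Lemma cvg_dnbhs_mul (c : C) : c != 0 -> c * w @[w --> (0 : C)^'] --> (0 : C)^'.
Proof.
move=> c0 P [e /= e0 eP].
have ce0' : 0 < e / `|c| by rewrite divr_gt0 // normr_gt0.
exists (e / `|c|) => // w /= hw w0; apply: eP; last by rewrite mulf_neq0.
move: hw; rewrite /ball /= !sub0r !normrN normrM => hw.
by rewrite mulrC -ltr_pdivlMr ?normr_gt0.
Qed.

Lemma tanh_cot_cvg0 : tanh_cot w @[w --> (0 : C)^'] --> (1 : C).
Proof.
have p0 := piC_neq0; pose i := imag_unit R; have i0 : i != 0 := imag_unit_neq0 R.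
have c1 : piC / 2 != 0 by rewrite mulf_neq0 // invr_eq0.
have c2 : i * (piC / 2) != 0 by rewrite mulf_neq0.
have r1 := cvg_comp _ _ (cvg_dnbhs_mul c1) (@csin_ratio_cvg R).
have r2 := cvg_comp _ _ (cvg_dnbhs_mul c2) (@csin_ratio_cvg R).
have r3 := cvg_comp _ _ (cvg_dnbhs_mul c1) (@ccos_cvg R).
have r4 := cvg_comp _ _ (cvg_dnbhs_mul c2) (@ccos_cvg R).
have o0 := oner_neq0 C.
have F0 := @dnbhs_filter C 0.
have rr := cvg_mulC F0 (cvg_divC F0 o0 r2 r1) (cvg_divC F0 o0 r3 r4).
rewrite divr1 mulr1 in rr.
apply: cvg_trans rr; apply: near_eq_cvg.
near=> w; have w0 : w != 0 by near: w; exact: nbhs_dnbhs_neq.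
rewrite tanh_cotE /=.
have -> : piC * w / 2 = piC / 2 * w by rewrite mulrAC.
rewrite -/i -[i * (piC / 2) * w]mulrA; have y0 : piC / 2 * w != 0 by rewrite mulf_neq0.
move: (piC / 2 * w) y0 => y y0.
have -> : - i = i^-1.
  by apply: (mulfI i0); rewrite divff // mulrN; have := imag_unit_mul R;
    rewrite -/i => ->; rewrite opprK.
rewrite (invfM (csinC y)) invrK.
move: (csinC y)^-1 (ccosC (i * y))^-1 (ccosC y) (csinC (i * y)) => a b c d.
by field; rewrite i0 y0.
Unshelve. all: by end_near.
Qed.


(** * Generating functions of the star values *)

Section GeneratingFunctions.
Variables (z : C) (t : seq nat).
Hypothesis hz : `|z| < 1.
Local Notation zs := (zeta_trunc R).
Hypothesis ht : forall n, zs t n.+1 <= trunc_bound R n.+1.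
Hypothesis ht0 : zs t 0 <= 2.
Hypothesis hc : forall d, zs (rep31 d ++ t) n @[n --> \oo] --> zeta_star R (rep31 d ++ t).

Lemma zeta_trunc_rep31_le2 d n : zs (rep31 d ++ t) n <= 2.
Proof.
case: n => [|n].
  by case: d => [//|d]; rewrite [rep31 _ ++ _]/= zeta_trunc0.
exact: le_trans (zeta_trunc_rep31_le ht d n) (trunc_bound_le2 R _).
Qed.

Lemma norm_term_le (c M : R) (m j : nat) (r : R) : `|z| = r%:C -> r < 1 ->
  0 <= c <= M -> `|c%:C * z ^+ (4 * m + j)| <= (geometric M (r ^+ 4) m)%:C.
Proof.
move=> zr r1 /andP[c0 cM]; have r0 : 0 <= r by rewrite -lecR -zr; exact: normr_ge0.
rewrite normrM normrX zr ger0_norm; last by rewrite -(rmorph0 (real_complex R)) lecR.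
rewrite -rmorphXn -rmorphM lecR /=; apply: ler_pM => //; first exact: exprn_ge0.
rewrite -exprM exprD ler_piMr ?exprn_ge0 //.
by rewrite exprn_ile1 // ltW.
Qed.

(** The system satisfied by the generating functions of the truncated sums, for an
    arbitrary tail t of the index; here H belongs to the indices with one more
    leading 1. The inhomogeneous term comes from the index t alone. *)
Lemma star_generating : exists (F H : nat -> C) (A : C),
  [/\ F 0%N = (zs t 0)%:C, H 0%N = 0,
      forall n, F n.+1 - F n = (zs t n.+1 - zs t n)%:C + z ^+ 3 / n.+1%:R ^+ 3 * H n.+1,
      forall n, H n.+1 - H n = z / n.+1%:R * F n.+1 &
      F @ \oo --> A /\
      series (fun d => (zeta_star R (rep31 d ++ t))%:C * z ^+ (4 * d)) @ \oo --> A].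
Proof.
have [r zr] : exists r, `|z| = r%:C by apply/complex_realP; exact: normr_real.
have r0 : 0 <= r by rewrite -lecR -zr; exact: normr_ge0.
have r1 : r < 1 by rewrite -ltcR -zr.
have cg M : cvgn (series (geometric M (r ^+ 4))).
  by apply: is_cvg_geometric_series; rewrite ger0_norm ?exprn_ge0 // exprn_ilt1.
pose f n d : C := (zs (rep31 d ++ t) n)%:C * z ^+ (4 * d).
pose h n d : C := (zs (1%N :: rep31 d ++ t) n)%:C * z ^+ (4 * d + 1).
have [|||F [A [F1 F2 F3]]] := @tannery R f (fun d => (zeta_star R (rep31 d ++ t))%:C * z
  ^+ (4 * d)) (geometric 2 (r ^+ 4)).
- move=> n k; rewrite /f -[(4 * k)%N]addn0; apply: norm_term_le => //.
  by rewrite zeta_trunc_ge0 zeta_trunc_rep31_le2.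
- exact: cg.
- move=> k; have e := cvg_real_complex eventually_filter (@hc k).
  exact: (cvg_mulC eventually_filter e (cvg_cst (z ^+ (4 * k)))).
have hH n : exists S : C, series (h n) @ \oo --> S.
  have [|||G [B [G1 _ _]]] := @tannery R (fun _ => h n) (h n) (geometric (n%:R *
    trunc_bound R n) (r ^+ 4)).
  - move=> _ k; rewrite /h; apply: norm_term_le => //.
    by rewrite zeta_trunc_ge0 zeta_trunc1_le // => m; exact: zeta_trunc_rep31_le.
  - exact: cg.
  - move=> k; exact: cvg_cst.
  by exists (G 0%N); exact: G1.
pose H n : C := xget (0 : C) [set S : C | series (h n) @ \oo --> S].
have H1 n : series (h n) @ \oo --> H n.
  by rewrite /H; case: xgetP => [S -> //|hn]; have [S hS] := hH n; case: (hn S).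
exists F, H, A; split => //.
- apply: (cvg_unique _ (F1 0%N)); first exact: norm_hausdorff.
  have := @cvg_series_fin R (f 0%N) 1.
  rewrite big_ord1 /f muln0 expr0 mulr1; apply => -[//|k] _.
  by rewrite [rep31 _ ++ _]/= zeta_trunc0 mul0r.
- apply: (cvg_unique _ (H1 0%N)); first exact: norm_hausdorff.
  have := @cvg_series_fin R (h 0%N) 0; rewrite big_ord0; apply => k _.
  by rewrite /h zeta_trunc0 mul0r.
- move=> n.
  have up m : (m <= m.+1)%N by [].
  have l1 : series (f n.+1) N.+1 - series (f n) N.+1 @[N --> \oo] --> F n.+1 - F n.
    exact: (cvgB (cvg_subseq up (F1 n.+1)) (cvg_subseq up (F1 n))).
  have l2 : ((zs t n.+1 - zs t n)%:C : C) + z ^+ 3 / n.+1%:R ^+ 3 * series (h n.+1) N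
      @[N --> \oo] --> ((zs t n.+1 - zs t n)%:C : C) + z ^+ 3 / n.+1%:R ^+ 3 * H n.+1.
    apply: cvgD; first exact: cvg_cst.
    exact: (cvg_mulC eventually_filter (cvg_cst (z ^+ 3 / n.+1%:R ^+ 3)) (H1 n.+1)).
  apply: (cvg_unique _ l1); first exact: norm_hausdorff.
  rewrite (_ : (fun N => _ - _) = (fun N => ((zs t n.+1 - zs t n)%:C : C) +
      z ^+ 3 / n.+1%:R ^+ 3 * series (h n.+1) N)); first exact: l2.
  apply/funext => N; rewrite /series /= -sumrB big_nat_recl //=; congr (_ + _).
    by rewrite /f muln0 expr0 !mulr1 rmorphB.
  rewrite mulr_sumr; apply: eq_bigr => d _; rewrite /f /h.
  have -> : rep31 d.+1 ++ t = [:: 3, 1 & rep31 d ++ t]%N by [].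
  rewrite zeta_truncS; move: (zs (3%N :: _) n) (zs (1%N :: _) n.+1) => a b.
  rewrite rmorphD rmorphM fmorphV rmorphXn /= rmorph_nat mulnS addnC !exprD expr1.
  move: (a%:C : C) (b%:C : C) => {}a {}b.
  have n0 : n.+1%:R ^+ 3 != 0 :> C by rewrite expf_neq0 // pnatr_eq0.
  by move: (n.+1%:R ^+ 3 : C) (z ^+ (4 * d)) n0 => m p m0; field.
- move=> n.
  have l1 : series (h n.+1) N - series (h n) N @[N --> \oo] --> H n.+1 - H n.
    exact: (cvgB (H1 n.+1) (H1 n)).
  have l2 := cvg_mulC eventually_filter (cvg_cst (z / n.+1%:R)) (F1 n.+1).
  apply: (cvg_unique _ l1); first exact: norm_hausdorff.
  rewrite (_ : (fun N => _ - _) = (fun N => z / n.+1%:R * series (f n.+1) N));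
    first exact: l2.
  apply/funext => N; rewrite /series /= -sumrB mulr_sumr; apply: eq_bigr => d _;
    rewrite /f /h.
  rewrite zeta_truncS expr1; move: (zs (1%N :: _) n) (zs (rep31 _ ++ _) n.+1) => a b.
  rewrite rmorphD rmorphM fmorphV /= rmorph_nat exprD expr1.
  move: (a%:C : C) (b%:C : C) => {}a {}b.
  have n0 : n.+1%:R != 0 :> C by rewrite pnatr_eq0.
  by move: (n.+1%:R : C) (z ^+ (4 * d)) n0 => m p m0; field.
Qed.

End GeneratingFunctions.

End Limits.

(** * The identity *)

Lemma zeta_star_nil (R : realType) : zeta_star R [::] = 1.
Proof.
have := @esum_chains_below R [::] 0 1 ler01; rewrite mulr1.
under eq_esum do rewrite mul1r.
have -> : @chains_below 0%N 0%N = [set k : 0.-tuple nat | sorted geq k /\ all (leq 1) k].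
  by apply/seteqP; split => k; rewrite /chains_below /= (tuple0 k).
by rewrite /zeta_star /zeta_term => ->.
Qed.

Lemma cvg_zeta_trunc_rep31 (R : realType) (t : seq nat) :
  (forall n, zeta_trunc R t n.+1 <= trunc_bound R n.+1) ->
  zeta_trunc R t 0 <= 2 ->
  zeta_trunc R t n @[n --> \oo] --> zeta_star R t ->
  forall d, zeta_trunc R (rep31 d ++ t) n @[n --> \oo] --> zeta_star R (rep31 d ++ t).
Proof.
move=> ht ht0 htc [//|d]; apply: (@cvg_zeta_trunc R 3 (1%N :: rep31 d ++ t) 2) => n.
exact: (@zeta_trunc_rep31_le2 R t ht ht0 d.+1 n).
Qed.

Unset Implicit Arguments.

Theorem theorem2p3 (R : realType) (z : CC R) (hz : `|z| < 1) :
  exists A B : CC R,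
    [/\ series (fun d => ((zeta_star R (rep31 d))%:C : CC R) * z ^+ (4 * d))
          @ \oo --> A,
        series (fun d => ((zeta_star R (rep31 d ++ [:: 2%N]))%:C : CC R)
                           * z ^+ (4 * d + 2)) @ \oo --> B,
        z != 0 -> A - B = tanh_cot z
      & z = 0 -> tanh_cot w @[w --> (0 : CC R)^'] --> A - B].
Proof.
have hx : `|z ^+ 2| < 1 by rewrite normrX expr_lt1.
have t0 : zeta_trunc R [::] 0 <= 2 by rewrite /= ler1n.
have t2 : zeta_trunc R [:: 2%N] 0 <= 2 by rewrite zeta_trunc0.
have c0 : zeta_trunc R [::] n @[n --> \oo] --> zeta_star R [::].
  by rewrite zeta_star_nil; exact: cvg_cst.
have c2 : zeta_trunc R [:: 2%N] n @[n --> \oo] --> zeta_star R [:: 2%N].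
  apply: (@cvg_zeta_trunc R 2 [::] 2) => -[//|n].
  exact: le_trans (zeta_trunc2_le R n) (trunc_bound_le2 R _).
have [F [H [A [F0 H0 FS HS [FA sA]]]]] := star_generating hz (zeta_trunc_nil_le R)
  t0 (cvg_zeta_trunc_rep31 (zeta_trunc_nil_le R) t0 c0).
have [G [K [B [G0 K0 GS KS [GB sB]]]]] := star_generating hz (zeta_trunc2_le R)
  t2 (cvg_zeta_trunc_rep31 (zeta_trunc2_le R) t2 c2).
have [W [W1 W2]] := solution_even_cvg hx.
have DE n : F n - z ^+ 2 * G n = solution_even (z ^+ 2) n.
  apply: (@solution_unique _ z (sub_alt_neq0 hx) (fun n => F n - z ^+ 2 * G n)
    (fun n => H n - z ^+ 2 * K n)).
  - move=> m; apply: contraTneq hx => h.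
    have {}h : `|z| ^+ 4 = m.+1%:R ^+ 4 by rewrite -normrX h normrX normr_nat.
    rewrite normrX le_gtF // -(@ler_pXn2r _ 2) ?nnegrE ?exprn_ge0 //.
    by rewrite -exprM h expr1n -natrX -[1]/(1%:R) ler_nat expn_gt0.
  - by rewrite F0 G0 zeta_trunc0 mulr0 subr0.
  - by rewrite H0 K0 mulr0 subr0.
  - move=> m; transitivity ((F m.+1 - F m) - z ^+ 2 * (G m.+1 - G m)); first by ring.
    have nilE k : zeta_trunc R [::] k = 1 by [].
    have dE : zeta_trunc R [:: 2%N] m.+1 - zeta_trunc R [:: 2%N] m = (m.+1%:R ^+ 2)^-1.
      by rewrite zeta_truncS nilE mulr1 addrAC subrr add0r.
    rewrite FS GS dE !nilE subrr rmorph0.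
    rewrite fmorphV rmorphXn /= rmorph_nat; ring.
  - move=> m; transitivity ((H m.+1 - H m) - z ^+ 2 * (K m.+1 - K m)); first by ring.
    by rewrite HS KS; ring.
have AB : A - z ^+ 2 * B = W.
  have l : F n - z ^+ 2 * G n @[n --> \oo] --> A - z ^+ 2 * B.
    exact: (cvgB FA (cvg_mulC eventually_filter (cvg_cst (z ^+ 2)) GB)).
  apply: (cvg_unique _ l); first exact: norm_hausdorff.
  rewrite (_ : (fun n => _) = solution_even (z ^+ 2)); first exact: W1.
  exact: funext.
(* The factor z^2 turns the exponents 4 d of the generating function with tail 2
   into 4 d + 2. *)
exists A, (z ^+ 2 * B); split.
- rewrite (_ : (fun d => _) = (fun d => (zeta_star R (rep31 d ++ [::]))%:C * z ^+ (4 *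
  d))); first exact: sA.
  by apply/funext => d; rewrite cats0.
- have l := cvg_mulC eventually_filter (cvg_cst (z ^+ 2)) sB.
  rewrite (_ : series _ = (fun N => z ^+ 2 * series (fun d =>
    (zeta_star R (rep31 d ++ [:: 2%N]))%:C * z ^+ (4 * d)) N)); first exact: l.
  apply/funext => N; rewrite /series /= mulr_sumr; apply: eq_bigr => d _.
  by rewrite exprD [RHS]mulrC mulrA.
- by move=> z0; rewrite AB; exact: (alt_prod_cvg hz z0 W2).
(* At z = 0 every factor of W is 1. *)
- move=> z0; suff -> : A - z ^+ 2 * B = 1 by exact: tanh_cot_cvg0.
  rewrite AB; apply: (cvg_unique _ W2); first exact: norm_hausdorff.
  rewrite (_ : alt_prod _ = fun=> 1); first exact: cvg_cst.
  apply/funext => n; rewrite /alt_prod big1 // => k _.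
  by rewrite z0 expr0n mulr0 addr0 subr0 divff // expf_neq0 // pnatr_eq0.
Qed.
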